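(* Let $n\ge 1$, $\lambda>0$, and let $P(\boldsymbol\theta)=\sum_{T\subset[n]}p_T\boldsymbol\theta^T$ be an affine polynomial in $\boldsymbol\theta=(\theta_1,\dots,\theta_n)$ with $p_\varnothing=1$, $p_T\neq 0$ for all $T\subset[n]$, $p_{\{i\}}>0$ for all $i\in[n]$ and $p_{[n]}>0$, such that the multivariate gamma distribution $\boldsymbol\gamma_{(P,\lambda)}$ associated with $(P,\lambda)$ exists and is infinitely divisible. Let $R=R_n$ be the affine polynomial attached to $P$ (defined in the context), and let $c_{\boldsymbol\alpha,\lambda}(R)$, $\boldsymbol\alpha\in\mathbb N^n$, be the coefficients of the power series expansion at $\mathbf z=\mathbf 0$ $$[1-R(\mathbf z)]^{-\lambda}=\sum_{\boldsymbol\alpha\in\mathbb N^n}c_{\boldsymbol\alpha,\lambda}(R)\,\mathbf z^{\boldsymbol\alpha}.$$ Then $$\boldsymbol\gamma_{(P,\lambda)}(\mathrm d\mathbf x)=\frac{p_{[n]}^{-\lambda}}{[\Gamma(\lambda)]^n}\exp\big(\langle\boldsymbol\theta_P,\mathbf x\rangle\big)\,\Big(\prod_{i=1}^n x_i\Big)^{\lambda-1}\Big[\sum_{\boldsymbol\alpha\in\mathbb N^n}\frac{c_{\boldsymbol\alpha,\lambda}(R)}{(\lambda)_{\boldsymbol\alpha}}\mathbf x^{\boldsymbol\alpha}\Big]\mathbf 1_{(0,\infty)^n}(\mathbf x)\,\mathrm d\mathbf x ,$$ and in this formula the sum may equivalently be restricted to those $\boldsymbol\alpha$ with $c_{\boldsymbol\alpha,\lambda}(R)\ne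 0$.
   Context: Notation: $\mathbb N=\{0,1,2,\dots\}$, $[n]=\{1,\dots,n\}$; for $\mathbf z\in\mathbb R^n$, $T\subset[n]$, $\boldsymbol\alpha\in\mathbb N^n$: $\mathbf z^T=\prod_{t\in T}z_t$ and $\mathbf z^{\boldsymbol\alpha}=\prod_i z_i^{\alpha_i}$. $\overline T=[n]\setminus T$. Braces are omitted in indices: $p_i=p_{\{i\}}$. An affine polynomial is a polynomial of degree at most one in each variable. $(\lambda)_k=\Gamma(\lambda+k)/\Gamma(\lambda)$ and $(\lambda)_{\boldsymbol\alpha}=\prod_{i=1}^n(\lambda)_{\alpha_i}$. $\langle\cdot,\cdot\rangle$ is the standard inner product. The multivariate gamma distribution $\boldsymbol\gamma_{(P,\lambda)}$ associated with $(P,\lambda)$ is the probability distribution on $\mathbb R^n$ of a random vector $\mathbf X$ such that $\mathbb E[\exp(-\sum_i\theta_iX_i)]=[P(\boldsymbol\theta)]^{-\lambda}$ for $\boldsymbol\theta$ in a set with non-empty interior. It is infinitely divisible if for every $t>0$ the function $[P(\boldsymbol\theta)]^{-\lambda t}$ is the Laplace transform of a positive measure. Set $\widetilde p_T=-p_{\overline T}/p_{[n]}$ for $T\subset[n]$ (so $\widetilde p_\varnothing=-1$) and $\boldsymbol\theta_P=(\widetilde p_1,\dots,\widetilde p_n)$. The polynomial $R_n$ is $R_n(\mathbf z)=\sum_{T\subset[n],|T|\ge 2}r_T\mathbf z^T$ with $r_T=-\frac1{p_{[n]}}\big(\prod_{i\in\overline T}\frac{\partial}{\partial\theta_i}\big)P\,(\boldsymbol\theta_P)$;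 for $n=1$, $R_1=0$. Equivalently, $P(\boldsymbol\theta)=p_{[n]}\prod_{i}(\theta_i-\widetilde p_i)\{1-R_n((\theta_1-\widetilde p_1)^{-1},\dots,(\theta_n-\widetilde p_n)^{-1})\}$. *)

(* Defs.v *)
From HB Require Import structures.
From mathcomp Require Import all_boot all_order all_algebra.
From mathcomp Require Import all_classical all_reals all_analysis.

Set Implicit Arguments.
Unset Strict Implicit.
Unset Printing Implicit Defensive.
Import Order.TTheory GRing.Theory Num.Theory.
Import numFieldNormedType.Exports.
Local Open Scope classical_set_scope.
Local Open Scope ring_scope.

(* A point of R^n is an n.-tuple R where the Borel sigma-algebra is needed and
   a row vector 'rV[R]_n where the topology or derivatives are needed; functions
   that are merely evaluated take a family 'I_n -> R, obtained as tnth x or as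
   theta 0.  The index set {1,...,n} is 'I_n.  This is a MathComp-Analysis
   development over an arbitrary realType. *)

Section Lebesgue.
Context {R : realType}.

Definition tuple_consp n (p : measurableTypeR R * n.-tuple R) : n.+1.-tuple R :=
  [tuple of (p.1 : R) :: p.2].

Lemma measurable_tuple_consp n : measurable_fun setT (@tuple_consp n).
Proof.
apply: (@measurable_cons _ _ _ R fst n snd); [exact: measurable_fst|exact: measurable_snd].
Qed.

Section step.
Context n (mu : {sigma_finite_measure set (n.-tuple R) -> \bar R}).

Definition lebS : set (n.+1.-tuple R) -> \bar R :=
  pushforward (@lebesgue_measure R \x mu)%E (@tuple_consp n).

Let lebS0 : lebS set0 = 0%E.
Proof. by rewrite /lebS /pushforward preimage_set0 measure0. Qed.

Let lebS_ge0 A : (0 <= lebS A)%E.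
Proof. exact: (measure_ge0 (@lebesgue_measure R \x mu)%E). Qed.

Let lebS_sigma_additive : semi_sigma_additive lebS.
Proof.
have mc := @measurable_tuple_consp n.
move=> F mF tF mUF; rewrite /lebS /pushforward preimage_bigcup.
apply: measure_semi_sigma_additive.
- by move=> k; rewrite -[X in measurable X]setTI; exact: mc.
- apply/trivIsetP => /= i j _ _ ij; rewrite -preimage_setI.
  by move/trivIsetP : tF => /(_ _ _ _ _ ij) ->//; rewrite preimage_set0.
- by rewrite -preimage_bigcup -[X in measurable X]setTI; exact: mc.
Qed.

HB.instance Definition _ :=
  isMeasure.Build _ _ _ lebS lebS0 lebS_ge0 lebS_sigma_additive.

Let lebS_sigma_finite : sigma_finite setT lebS.
Proof.
have /sigma_finiteP[F [TF ndF Foo]] := sigma_finiteT (@lebesgue_measure R).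
have /sigma_finiteP[G [TG ndG Goo]] := sigma_finiteT mu.
exists (fun k => [set t | F k (thead t) /\ G k [tuple of behead t]]).
  apply/seteqP; split=> // t _.
  have [k _ Fk] : (\bigcup_i F i) (thead t) by rewrite -TF.
  have [l _ Gl] : (\bigcup_i G i) [tuple of behead t] by rewrite -TG.
  exists (maxn k l) => //; split.
  - by move: (thead t) Fk; exact/subsetPset/ndF/leq_maxl.
  - by move: [tuple of behead t] Gl; exact/subsetPset/ndG/leq_maxr.
move=> k; have [mF Fk] := Foo k; have [mG Gk] := Goo k; split.
  apply: measurableI; rewrite -[X in measurable X]setTI.
    exact: measurable_tnth.
  exact: measurable_behead.
rewrite /lebS /pushforward (_ : _ @^-1` _ = F k `*` G k); last first.
  apply/seteqP; split=> -[x t] /=; rewrite theadE;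
    by rewrite (_ : [tuple of _] = t)//; exact/val_inj.
by rewrite product_measure1E// lte_mul_pinfty// ge0_fin_numE.
Qed.

HB.instance Definition _ :=
  Measure_isSigmaFinite.Build _ _ _ lebS lebS_sigma_finite.

End step.

(* Lebesgue measure on R^n as an iterated product measure; leb_box below is its
   usual characterization by boxes. *)
Fixpoint leb n : {sigma_finite_measure set (n.-tuple R) -> \bar R} :=
  match n with
  | 0 => \d_([tuple] : 0.-tuple R)
  | m.+1 => lebS (leb m)
  end.

Lemma leb_box n (A : 'I_n -> set R) : (forall i, measurable (A i)) ->
  leb n [set x | forall i, A i (tnth x i)] =
  (\prod_(i < n) @lebesgue_measure R (A i))%E.
Proof.
elim: n A => [|n IHn] A mA /=.
  by rewrite big_ord0 diracE mem_set//= => -[].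
have mS : measurable [set x : n.-tuple R | forall i, A (lift ord0 i) (tnth x i)].
  rewrite (_ : [set x | _] =
    \bigcap_(i in [set: 'I_n]) ((@tnth n R)^~ i @^-1` A (lift ord0 i))).
    apply: fin_bigcap_measurable => // i _; rewrite -[X in measurable X]setTI.
    exact: measurable_tnth.
  by apply/seteqP; split=> x /= H i; [move=> _; exact: H|exact: H].
rewrite big_ord_recl -IHn// -product_measure1E//.
congr (product_measure1 _ _ _); apply/seteqP; split=> -[x t]/=.
  move=> H; split; first exact: (H ord0).
  by move=> i; have := H (lift ord0 i); rewrite tnthS.
move=> [A0 AS] i; case: (unliftP ord0 i) => [j ->|->//].
by rewrite tnthS.
exact: mA.
Qed.

End Lebesgue.

Section Sums.
Context {R : realType} {I : choiceType}.

Definition abs_summable (D : set I) (f : I -> R) : Prop :=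
  summable D (EFin \o f).

(* Sum of an absolutely summable real family; \esum alone is meaningful only
   for nonnegative families. *)
Definition abs_sum (D : set I) (f : I -> R) : R :=
  fine (\esum_(i in D) (EFin \o f)^\+ i - \esum_(i in D) (EFin \o f)^\- i)%E.

End Sums.

Section AffinePolynomials.
Context {R : realType} {n : nat}.
Implicit Types (p : {set 'I_n} -> R) (v : 'I_n -> R) (T : {set 'I_n}).

Definition affine p v : R := \sum_(T : {set 'I_n}) p T * \prod_(t in T) v t.

Definition pderiv (i : 'I_n) (F : 'rV[R]_n -> R) : 'rV[R]_n -> R :=
  fun theta => 'D_(delta_mx 0 i) F theta.

Definition pderivs T (F : 'rV[R]_n -> R) : 'rV[R]_n -> R :=
  foldr pderiv F (enum T).

Definition ptilde p T : R := - p (~: T) / p [set: 'I_n]%SET.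

Definition thetaP p : 'rV[R]_n := \row_i ptilde p [set i]%SET.

(* These make P(theta) = p_[n] \prod_i (theta_i - a_i) (1 - R(z)), where
   z_i = (theta_i - a_i)^-1 and a = thetaP p, the Taylor expansion of P at a; the
   coefficients indexed by singletons vanish by the choice of a. *)
Definition rcoef p T : R :=
  if (2 <= #|T|)%N then
    - (p [set: 'I_n]%SET)^-1
    * pderivs (~: T) (fun theta => affine p (theta 0)) (thetaP p)
  else 0.

Definition Rpoly p v : R := affine (rcoef p) v.

End AffinePolynomials.

Section PowerSeries.
Context {R : realType} {n : nat}.

Definition monom (alpha : {ffun 'I_n -> nat}) (v : 'I_n -> R) : R :=
  \prod_(i < n) v i ^+ alpha i.

Definition power_series_at0 (f : 'rV[R]_n -> R) (c : {ffun 'I_n -> nat} -> R) :=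
  \forall z \near (0 : 'rV[R]_n),
    f z = abs_sum setT (fun alpha => c alpha * monom alpha (z 0)) /\
    abs_summable setT (fun alpha => c alpha * monom alpha (z 0)).

End PowerSeries.

Section GammaFunction.
Context {R : realType}.

Definition Gamma (a : R) : R :=
  \int[@lebesgue_measure R]_(t in `]0, +oo[) (t `^ (a - 1) * expR (- t)).

Definition poch (a : R) (k : nat) : R := Gamma (a + k%:R) / Gamma a.

Definition mpoch n (a : R) (alpha : {ffun 'I_n -> nat}) : R :=
  \prod_(i < n) poch a (alpha i).

End GammaFunction.

Section MultivariateGamma.
Context {R : realType} {n : nat}.
Implicit Types (P : 'rV[R]_n -> R) (s lambda : R).

Definition inner (u v : 'I_n -> R) : R := \sum_(i < n) u i * v i.

(* P^(-s) is the Laplace transform of mu on some set with non-empty interior;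
   P has to be positive there for a real power of it to make sense. *)
Definition laplace_power (mu : {measure set (n.-tuple R) -> \bar R}) P s :=
  exists Theta : set 'rV[R]_n, interior Theta !=set0 /\
    forall theta, Theta theta ->
      0 < P theta /\
      (\int[mu]_x (expR (- inner (theta 0) (tnth x)))%:E)%E
        = (P theta `^ (- s))%:E.

Definition is_mgamma (mu : probability (n.-tuple R) R) P lambda :=
  laplace_power mu P lambda.

Definition mgamma_infinitely_divisible P lambda :=
  forall t : R, 0 < t ->
    exists nu : {measure set (n.-tuple R) -> \bar R},
      laplace_power nu P (lambda * t).

Definition pos_orthant : set (n.-tuple R) :=
  [set x | forall i, 0 < tnth x i].

Definition mgamma_density (p : {set 'I_n} -> R) lambda
    (c : {ffun 'I_n -> nat} -> R) (D : set {ffun 'I_n -> nat})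
    (x : n.-tuple R) : R :=
  p [set: 'I_n]%SET `^ (- lambda) / Gamma lambda ^+ n
  * expR (inner (thetaP p 0) (tnth x))
  * (\prod_(i < n) tnth x i) `^ (lambda - 1)
  * abs_sum D (fun alpha => c alpha / mpoch lambda alpha * monom alpha (tnth x))
  * \1_pos_orthant x.

End MultivariateGamma.

(* Main.v *)
Require Import Defs.
From HB Require Import structures.
From mathcomp Require Import all_boot all_order all_algebra.
From mathcomp Require Import all_classical all_reals all_analysis.
From mathcomp Require Import measurable_realfun ring lra.

Set Implicit Arguments.
Unset Strict Implicit.
Unset Printing Implicit Defensive.
Import Order.TTheory GRing.Theory Num.Theory.
Import numFieldNormedType.Exports.
Local Open Scope classical_set_scope.
Local Open Scope ring_scope.

(* The Laplace transform of gamma equals P^(-lambda) near some point.  Since P is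
   affine in each variable, along every coordinate axis it is locally a power of
   an affine function, hence coincides with the transform of a one-dimensional
   gamma law as far as the latter is finite.  This locates the support of gamma
   in an orthant, up to signs, and propagates the identity L = P^(-lambda) to the
   open orthant of the same signs; as P > 0 there while P = 1 + p_i theta_i with
   p_i > 0 on the i-th axis, all signs are positive.
   On the other hand, for large theta, integrating the series term by term shows
   that the announced (a priori signed) density f also has the transform
   p_[n]^(-lambda) prod_i z_i^lambda (1 - R(z))^(-lambda) = P(theta)^(-lambda)
   with z_i = (theta_i - a_i)^-1 and a = thetaP p.  Uniqueness of Laplace
   transforms on a shifted orthant yields gamma + f^- = f^+ as measures, which
   forces f^- = 0. *)

(** Analytic continuation is replaced by a real argument: combinations of exponentials whose
    exponents stay near one point approximate an exponential with a distant exponent, and finiteness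
    of the transform there is part of the conclusion. It is applied one coordinate at a time,
    because along a coordinate line P^(-lambda) is the transform of an explicit positive measure.
    The obstacle is that the two descriptions of the transform live in different places. The
    hypothesis holds near one unknown point, whereas the expansion of [1 - R(z)]^(-lambda) is known
    only near z = 0, that is for theta far out in the positive orthant. The identity has to be
    carried there before anything can be compared. As the signs of the coefficients [c] are unknown,
    they are split into positive and negative parts: sums and integrals are exchanged for
    nonnegative terms only, and only finite quantities are subtracted. *)

Section Density.
Local Open Scope ereal_scope.
Import HBNNSimple.

(** Used both to tilt a measure by an exponential and to form the measures with densities f^+ and
    f^-. Neither measure is assumed finite; the second clause goes from simple functions to [h] by
    monotone convergence. *)
Lemma density_measure d (T : measurableType d) (R : realType)
    (mu : {measure set T -> \bar R}) (g : T -> R) :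
  measurable_fun [set: T] g -> (forall x, 0 <= g x)%R ->
  exists m : {measure set T -> \bar R},
    (forall A, measurable A -> m A = \int[mu]_(x in A) (g x)%:E) /\
    forall h : T -> \bar R, measurable_fun [set: T] h -> (forall x, 0 <= h x) ->
      forall D, measurable D ->
      \int[m]_(x in D) h x = \int[mu]_(x in D) (h x * (g x)%:E).
Proof.
move=> mg g0.
pose nu A := \int[mu]_(x in A) (g x)%:E.
have nu0 : nu set0 = 0 by rewrite /nu integral_set0.
have nu_ge0 A : 0 <= nu A by apply: integral_ge0 => x _; rewrite lee_fin.
have nu_sa : semi_sigma_additive nu.
  move=> /= F mF tF mUF; rewrite /nu; apply: cvg_toP.
    apply: ereal_nondecreasing_is_cvgn => m n mn.
    by apply: lee_sum_nneg_natr => // k _ _; exact: nu_ge0.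
  rewrite ge0_integral_bigcup//=; last by move=> x _; rewrite lee_fin.
  exact/measurable_EFinP/measurable_funTS.
pose mix := isMeasure.Build _ _ _ nu nu0 nu_ge0 nu_sa.
pose m : {measure set T -> \bar R} := HB.pack nu mix.
exists m; split => // h mh h0 D mD.
have mhD : measurable_fun D h by exact: measurable_funTS.
pose f_ := nnsfun_approx mD mhD.
have fh x : D x -> (f_ ^~ x n)%:E @[n --> \oo] --> h x.
  by move=> Dx; apply: cvg_nnsfun_approx.
have ndf x : {homo (fun n => f_ n x) : a b / (a <= b)%N >-> (a <= b)%R}.
  by move=> a b ab; exact/lefP/nd_nnsfun_approx.
transitivity (limn (fun n => \int[m]_(x in D) (f_ n x)%:E)).
  rewrite -monotone_convergence//.
  - by apply: eq_integral => y /[!inE] yD; apply/esym/cvg_lim => //; exact: fh.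
  - by move=> n; exact/measurable_EFinP/measurable_funP.
  - by move=> n y _; rewrite lee_fin.
  - by move=> y _ a b ab; rewrite lee_fin; exact: ndf.
transitivity (limn (fun n => \int[mu]_(x in D) ((f_ n x)%:E * (g x)%:E))); last first.
  rewrite -monotone_convergence//.
  - apply: eq_integral => y /[!inE] yD; apply/cvg_lim => //.
    by apply: cvgeZr => //; exact: fh.
  - move=> n; apply: emeasurable_funM; last exact/measurable_EFinP/measurable_funTS.
    exact/measurable_EFinP/measurable_funP.
  - by move=> n y _; rewrite mule_ge0// lee_fin.
  - by move=> y _ a b ab; apply: lee_wpmul2r; rewrite lee_fin//; exact: ndf.
congr (limn _); apply/funext => n.
under eq_integral do rewrite fimfunE -fsumEFin//.
rewrite ge0_integral_fsum//; last 2 first.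
  - by move=> y; exact/measurable_EFinP/measurable_funM.
  - by move=> y x _; rewrite nnfun_muleindic_ge0.
under [RHS]eq_integral => x xD.
  rewrite fimfunE -fsumEFin// ge0_mule_fsuml; last first.
    by move=> i; rewrite nnfun_muleindic_ge0.
  over.
rewrite ge0_integral_fsum//; last 2 first.
  - move=> y; apply: emeasurable_funM; last exact/measurable_EFinP/measurable_funTS.
    exact/measurable_EFinP/measurable_funM.
  - by move=> y x _; apply: mule_ge0; [exact: nnfun_muleindic_ge0|rewrite lee_fin].
apply: eq_fsbigr => r _.
have mr : measurable (f_ n @^-1` [set r]) by exact: measurable_sfunP.
rewrite integralZl_indic_nnsfun// integral_indic//=.
have [r0|r0] := ltP r 0%R.
  rewrite preimage_nnfun0// set0I nu0 mule0.
  by under eq_integral do rewrite indic0 mulr0 mul0e; rewrite integral0.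
rewrite /nu setIC integral_mkcondr.
rewrite -ge0_integralZl ?lee_fin//; last 2 first.
  - by apply/(measurable_restrict _ mr mD)/measurable_EFinP/measurable_funTS.
  - by move=> x _; apply: erestrict_ge0 => y _; rewrite lee_fin.
apply: eq_integral => x _; rewrite EFinM -muleA; congr (_ * _).
rewrite patchE indicE; case: ifPn => _; first by rewrite mul1e.
by rewrite mul0e.
Qed.

End Density.

Lemma bernoulli_ineq (R : realDomainType) (u : R) (n : nat) :
  -1 <= u -> 1 + n%:R * u <= (1 + u) ^+ n.
Proof.
move=> u1; elim: n => [|n IHn]; first by rewrite mul0r addr0 expr0.
have u0 : 0 <= 1 + u by rewrite addrC -lerBlDr sub0r.
rewrite exprS; apply: le_trans (ler_wpM2l u0 IHn).
have -> : (1 + u) * (1 + n%:R * u) = 1 + n.+1%:R * u + n%:R * u ^+ 2.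
  by rewrite -natr1; ring.
by rewrite lerDl mulr_ge0// sqr_ge0.
Qed.

(** * Transfer of moment generating functions *)

Section ExpApprox.
Context {R : realType}.
Implicit Types (x : R) (N k : nat).

(* [1 + x / k <= emix N k x <= expR (x / k)], so [emix N k x ^+ k] approximates
   [expR x], while it is a combination of the [expR (s * x)] with
   [0 <= s <= 1 / N]: the exponents can be confined to any neighborhood of 0. *)
Definition emix N k x : R := 1 + N%:R * (expR (x / (N * k)%:R) - 1).

Let emix_arg N k x : (0 < N)%N -> x / k%:R = N%:R * (x / (N * k)%:R).
Proof.
move=> N0; rewrite natrM invfM [_^-1 * _]mulrC [RHS]mulrC -!mulrA mulVf ?mulr1//.
by rewrite pnatr_eq0 -lt0n.
Qed.

(** Bernoulli's inequality for u = exp(x/(Nk)) - 1, for which (1 + u)^N = exp(x/k). *)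
Lemma emix_le N k x : (0 < N)%N -> emix N k x <= expR (x / k%:R).
Proof.
move=> N0; rewrite /emix (emix_arg k x N0).
rewrite expRM_natl.
have := @bernoulli_ineq _ (expR (x / (N * k)%:R) - 1) N.
rewrite [1 + (_ - 1)]addrC subrK; apply.
by rewrite lerBrDr addNr expR_ge0.
Qed.

Lemma emix_ge N k x : (0 < N)%N -> 1 + x / k%:R <= emix N k x.
Proof.
move=> N0; rewrite /emix lerD2l (emix_arg k x N0).
by rewrite ler_wpM2l// lerBrDl expR_ge1Dx.
Qed.

Lemma emix_norm N k x : (0 < N)%N -> (0 < k)%N ->
  `|emix N k x ^+ k| <= expR `|x|.
Proof.
move=> N0 k0; rewrite normrX.
have -> : expR `|x| = expR (`|x| / k%:R) ^+ k.
  by rewrite -expRM_natl mulrC divfK// pnatr_eq0 -lt0n.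
apply: lerXn2r; rewrite ?nnegrE ?expR_ge0//.
have k0' : (0 : R) <= k%:R^-1 by rewrite invr_ge0.
rewrite ler_norml; apply/andP; split.
  apply: le_trans (emix_ge _ _ N0).
  have := expR_ge1Dx (`|x| / k%:R).
  have : - (x / k%:R) <= `|x| / k%:R.
    by rewrite -mulNr ler_wpM2r// -normrN ler_norm.
  lra.
apply: (le_trans (emix_le _ _ N0)).
by rewrite ler_expR ler_wpM2r// ler_norm.
Qed.

(** With y = x/k, (1 - y) exp(y) <= 1 gives (1 - y^2) exp(y) <= 1 + y; by Bernoulli, the k-th power
    of 1 - y^2 is at least 1 - k y^2 = 1 - x^2/k. *)
Lemma emix_ge_exp N k x : (0 < N)%N -> `|x| < k%:R ->
  (1 - x ^+ 2 / k%:R) * expR x <= emix N k x ^+ k.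
Proof.
move=> N0 xk.
have k0 : 0 < k%:R :> R by exact: le_lt_trans xk.
have [k0' k1] : k%:R != 0 :> R /\ 0 <= k%:R^-1 :> R.
  by rewrite gt_eqF// invr_ge0 ltW.
set y := x / k%:R.
have y1 : `|y| < 1.
  by rewrite normrM normfV (gtr0_norm k0) ltr_pdivrMr// mul1r.
have [yN1 yP1] : -1 < y /\ y < 1 by apply/andP; rewrite -ltr_norml.
have y2 : y ^+ 2 <= 1 by rewrite -real_normK ?num_real// expr_le1// ltW.
have ey : (1 - y ^+ 2) * expR y <= 1 + y.
  have := expR_ge1Dx (- y); rewrite expRN => h.
  have e0 := expR_gt0 y.
  have : (1 - y) * expR y <= 1.
    by rewrite -[leRHS](mulVf (lt0r_neq0 e0)) ler_wpM2r// ltW.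
  move=> h1.
  have -> : (1 - y ^+ 2) * expR y = (1 + y) * ((1 - y) * expR y) by ring.
  by rewrite -[leRHS]mulr1 ler_wpM2l//; lra.
apply: (@le_trans _ _ ((1 + y) ^+ k)); last first.
  have h : 1 + y <= emix N k x by exact: emix_ge.
  by apply: lerXn2r; rewrite ?nnegrE//; lra.
apply: (@le_trans _ _ (((1 - y ^+ 2) * expR y) ^+ k)); last first.
  apply: lerXn2r => //; rewrite nnegrE; last lra.
  by rewrite mulr_ge0 ?expR_ge0 ?subr_ge0.
rewrite exprMn -expRM_natl [k%:R * y]mulrC /y divfK// ler_wpM2r ?expR_ge0//.
have := @bernoulli_ineq _ (- y ^+ 2) k; rewrite lerN2 => /(_ y2).
apply: le_trans; rewrite le_eqVlt; apply/orP; left; apply/eqP.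
by rewrite /y; field.
Qed.

(** Even powers only: [emix] may be negative, and Fatou's lemma will require nonnegative
    approximants. *)
Lemma cvg_emix N x : (0 < N)%N ->
  emix N (j.+1.*2) x ^+ (j.+1.*2) @[j --> \oo] --> expR x.
Proof.
move=> N0.
have k2 : (fun j => (j.+1.*2)%:R^-1 : R) @ \oo --> 0.
  have -> : (fun j => (j.+1.*2)%:R^-1 : R) = (fun j => 2^-1 * j.+1%:R^-1).
    by apply/funext => j; rewrite -muln2 natrM invfM mulrC.
  by rewrite -(mulr0 2^-1); apply: cvgMr; exact: cvg_harmonic.
apply: (@squeeze_cvgr _ _ _ _ (fun j => (1 - x ^+ 2 / (j.+1.*2)%:R) * expR x)
   (fun=> expR x)).
- near=> j; apply/andP; split.
    apply: emix_ge_exp => //.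
    apply: (@lt_le_trans _ _ j%:R).
      by near: j; exact: nbhs_infty_gtr.
    by rewrite ler_nat -addnn addSn ltnW// ltnS leq_addr.
  have -> : expR x = expR (x / (j.+1.*2)%:R) ^+ (j.+1.*2).
    by rewrite -expRM_natl mulrC divfK// pnatr_eq0 double_eq0.
  apply: lerXn2r; rewrite ?nnegrE ?expR_ge0//; last exact: emix_le.
  apply: le_trans (emix_ge _ _ N0).
  have : `|x| < (j.+1.*2)%:R.
    apply: (@lt_le_trans _ _ j%:R); first by near: j; exact: nbhs_infty_gtr.
    by rewrite ler_nat -addnn addSn ltnW// ltnS leq_addr.
  rewrite ltr_norml => /andP[h _].
  rewrite -[leLHS](subrr 1) lerD2l lerNl -mulNr ler_pdivrMr ?ltr0n ?double_gt0//.
  by rewrite mul1r lerNl ltW.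
- rewrite [X in _ --> X](_ : _ = (1 - x ^+ 2 * 0) * expR x); last first.
    by rewrite mulr0 subr0 mul1r.
  by apply: cvgM; [apply: cvgB; [exact: cvg_cst|exact: cvgMr]|exact: cvg_cst].
- exact: cvg_cst.
Unshelve. all: by end_near. Qed.

End ExpApprox.

Section MomentGeneratingFunction.
Context d (T : measurableType d) {R : realType}.
Variables (m : {measure set T -> \bar R}) (Y : T -> R).
Hypothesis mY : measurable_fun [set: T] Y.

Definition mgf (s : R) : \bar R := (\int[m]_x (expR (s * Y x))%:E)%E.

Lemma measurable_mgf_fun s : measurable_fun [set: T] (fun x => expR (s * Y x)).
Proof. by apply: measurableT_comp => //; exact: measurable_funM. Qed.

Lemma integrable_mgf_fun s : (mgf s < +oo)%E ->
  m.-integrable [set: T] (fun x => (expR (s * Y x))%:E).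
Proof.
move=> h; apply/integrableP; split.
  exact/measurable_EFinP/measurable_mgf_fun.
by under eq_integral do rewrite gee0_abs ?lee_fin ?expR_ge0//.
Qed.

(** An approximation of exp((c + t) Y) which, once the power is expanded, is a combination of exp(s
    Y) with s between c and c + t/N. *)
Definition emix_fun N k c t (x : T) : R :=
  emix N k (t * Y x) ^+ k * expR (c * Y x).

Lemma measurable_emix_fun N k c t : measurable_fun [set: T] (emix_fun N k c t).
Proof.
apply: measurable_funM; last exact: measurable_mgf_fun.
apply: measurable_funX; apply: measurable_funD => //.
apply: measurable_funM => //; apply: measurable_funB => //.
apply: measurableT_comp => //; apply: measurable_funM => //.
exact: measurable_funM.
Qed.

Lemma cvg_emix_fun N c t x : (0 < N)%N ->
  emix_fun N (j.+1.*2) c t x @[j --> \oo] --> expR ((c + t) * Y x).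
Proof.
move=> N0; rewrite mulrDl addrC expRD.
by apply: cvgM; [exact: cvg_emix|exact: cvg_cst].
Qed.

(** From exp|u| <= exp(u) + exp(-u); this is why finiteness is later asked at both symmetric points
    c + t and c - t. *)
Lemma emix_fun_dominated N k c t x : (0 < N)%N -> (0 < k)%N ->
  `|emix_fun N k c t x| <= expR ((c + t) * Y x) + expR ((c - t) * Y x).
Proof.
move=> N0 k0; rewrite /emix_fun normrM (ger0_norm (expR_ge0 (c * _))).
apply: (@le_trans _ _ (expR `|t * Y x| * expR (c * Y x))).
  by rewrite ler_wpM2r ?expR_ge0// emix_norm.
rewrite !mulrDl !expRD mulNr.
have e0 := expR_ge0 (c * Y x); have e1 := expR_ge0 (t * Y x).
have e2 := expR_ge0 (- (t * Y x)).
case: (ler0P (t * Y x)) => _.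
  by rewrite mulrC lerDr mulr_ge0.
by rewrite mulrC lerDl mulr_ge0.
Qed.

Lemma cvg_integral_emix_fun N c t : (0 < N)%N ->
  (mgf (c + t) < +oo)%E -> (mgf (c - t) < +oo)%E ->
  (\int[m]_x (emix_fun N (j.+1.*2) c t x)%:E)%E @[j --> \oo] --> mgf (c + t).
Proof.
move=> N0 h1 h2.
have := @dominated_convergence _ _ _ m setT measurableT
  (fun j x => (emix_fun N (j.+1.*2) c t x)%:E)
  (fun x => (expR ((c + t) * Y x))%:E)
  (fun x => (expR ((c + t) * Y x))%:E + (expR ((c - t) * Y x))%:E)%E.
case.
- by move=> j; exact/measurable_EFinP/measurable_emix_fun.
- exact/measurable_EFinP/measurable_mgf_fun.
- apply: aeW => x _; apply: cvg_EFin; first exact: nearW.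
  exact: cvg_emix_fun.
- by apply: integrableD => //; exact: integrable_mgf_fun.
- apply: aeW => x j _; rewrite -EFinD lee_fin.
  exact: emix_fun_dominated.
- by [].
Qed.

Lemma mgf_le_emix_fun N c t (l : \bar R) : (0 < N)%N ->
  (\int[m]_x (emix_fun N (j.+1.*2) c t x)%:E)%E @[j --> \oo] --> l ->
  (mgf (c + t) <= l)%E.
Proof.
move=> N0 cvgl.
have mf j : measurable_fun setT (fun x => (emix_fun N (j.+1.*2) c t x)%:E).
  exact/measurable_EFinP/measurable_emix_fun.
have f0 j x : setT x -> (0 <= (emix_fun N (j.+1.*2) c t x)%:E)%E.
  move=> _; rewrite lee_fin mulr_ge0 ?expR_ge0//.
  by rewrite exprn_even_ge0// odd_double.
have := fatou m measurableT mf f0.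
rewrite is_cvg_limn_einfE; last by apply/cvg_ex; exists l.
rewrite (cvg_lim _ cvgl)//; apply: le_trans.
rewrite le_eqVlt; apply/orP; left; apply/eqP.
apply: eq_integral => x _.
have h : (emix_fun N (j.+1.*2) c t x)%:E @[j --> \oo] --> (expR ((c + t) * Y x))%:E.
  by apply: cvg_EFin; [exact: nearW|exact: cvg_emix_fun].
by rewrite is_cvg_limn_einfE ?(cvg_lim _ h)//; apply/cvg_ex; eexists; exact: h.
Qed.

End MomentGeneratingFunction.

Section Transfer.
Context d1 (T1 : measurableType d1) d2 (T2 : measurableType d2) {R : realType}.
Variables (m1 : {measure set T1 -> \bar R}) (Y1 : T1 -> R).
Variables (m2 : {measure set T2 -> \bar R}) (Y2 : T2 -> R).
Hypotheses (mY1 : measurable_fun [set: T1] Y1)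
           (mY2 : measurable_fun [set: T2] Y2).
Variables (c e : R).
Hypothesis eq12 : forall s, `|s - c| < e -> mgf m1 Y1 s = mgf m2 Y2 s.
Hypothesis fin2 : forall s, `|s - c| < e -> (mgf m2 Y2 s < +oo)%E.

Let G N k j t s d (T : measurableType d) (Y : T -> R) x :=
  (emix N k (t * Y x) ^+ j * expR (s * Y x))%:E.

(** Induction on the power [j]: a factor [emix] is (1 - N) + N exp(h Y) with h = t/(Nk), so it keeps
    the exponent [s] or shifts it by [h], and the premise leaves room for [j] shifts. Integrability
    is carried along because 1 - N may be negative. *)
Let eq_emix_fun N (k j : nat) t s : `|s - c| + j%:R * `|t / (N * k)%:R| < e ->
  [/\ m1.-integrable [set: T1] (G N k j t s Y1),
      m2.-integrable [set: T2] (G N k j t s Y2)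
    & (\int[m1]_x G N k j t s Y1 x = \int[m2]_x G N k j t s Y2 x)%E].
Proof.
set h := t / _; elim: j s => [|j IHj] s hs.
  have sc : `|s - c| < e by move: hs; rewrite mul0r addr0.
  have G0 d (T : measurableType d) (Y : T -> R) :
      G N k 0 t s Y = fun x => (expR (s * Y x))%:E.
    by apply/funext => x; rewrite /G expr0 mul1r.
  rewrite !G0; split; [apply: integrable_mgf_fun => //|apply: integrable_mgf_fun => //|].
  - by rewrite eq12// fin2.
  - by rewrite fin2.
  - exact: eq12.
have FE d (T : measurableType d) (Y : T -> R) : G N k j.+1 t s Y =
    (fun x => (1 - N%:R)%:E * G N k j t s Y x + N%:R%:E * G N k j t (s + h) Y x)%E.
  apply/funext => x; rewrite /G -!EFinM -EFinD; congr EFin.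
  rewrite exprSr [emix N k (t * Y x) in X in _ * X * _]/emix [(s + h) * _]mulrDl expRD.
  rewrite (_ : t * Y x / (N * k)%:R = h * Y x); last by rewrite mulrAC.
  ring.
have [] := IHj s.
  apply: le_lt_trans hs.
  by rewrite lerD2l ler_wpM2r// ler_nat.
have [] := IHj (s + h).
  apply: le_lt_trans hs; rewrite -natr1 mulrDl mul1r addrAC.
  by have := ler_normD (s - c) h; lra.
move=> i1 i2 e1 i3 i4 e2.
rewrite !FE; split.
- by apply: integrableD => //; exact: integrableZl.
- by apply: integrableD => //; exact: integrableZl.
- rewrite !integralD//; [|exact: integrableZl..].
  by rewrite !integralZl// e1 e2.
Qed.

(* The approximants of [expR ((c + t) * Y)] built from [emix] have equal integrals
   by [eq12]; Fatou's lemma then makes the generating function of [m1] finite at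
   [c + t] and [c - t], and dominated convergence concludes. *)
Lemma mgf_transfer t : (mgf m2 Y2 (c + t) < +oo)%E -> (mgf m2 Y2 (c - t) < +oo)%E ->
  0 < e -> mgf m1 Y1 (c + t) = mgf m2 Y2 (c + t).
Proof.
move=> fp fm e0.
(* After expansion all exponents lie within |t|/N of [c]; this [N] brings them inside the radius
   [e]. *)
pose N := (Num.truncn (`|t| / e)).+1.
have N0 : (0 < N)%N by [].
have tN : `|t| / N%:R < e.
  by rewrite ltr_pdivrMr ?ltr0n// mulrC -ltr_pdivrMr// truncnS_gt.
have eq_int t' j : `|t'| = `|t| ->
    (\int[m1]_x (emix_fun Y1 N (j.+1.*2) c t' x)%:E =
     \int[m2]_x (emix_fun Y2 N (j.+1.*2) c t' x)%:E)%E.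
  move=> t't; have [] // := @eq_emix_fun N (j.+1.*2) (j.+1.*2) t' c.
  rewrite subrr normr0 add0r normrM normfV (ger0_norm (ler0n _ _)) t't natrM.
  rewrite (_ : _ * _ = `|t| / N%:R)//; field.
  by rewrite !pnatr_eq0 double_eq0.
have cvg1 t' : `|t'| = `|t| ->
    (mgf m2 Y2 (c + t') < +oo)%E -> (mgf m2 Y2 (c - t') < +oo)%E ->
    (\int[m1]_x (emix_fun Y1 N (j.+1.*2) c t' x)%:E)%E @[j --> \oo]
      --> mgf m2 Y2 (c + t').
  move=> t't h1 h2; under eq_fun do rewrite eq_int//.
  exact: cvg_integral_emix_fun.
have finp : (mgf m1 Y1 (c + t) < +oo)%E.
  by apply: (le_lt_trans _ fp); apply: (mgf_le_emix_fun mY1 N0); apply: cvg1.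
have finm : (mgf m1 Y1 (c - t) < +oo)%E.
  apply: (le_lt_trans _ fm); apply: (mgf_le_emix_fun mY1 N0); apply: cvg1 => //.
    by rewrite normrN.
  by rewrite opprK.
apply: cvg_unique (cvg_integral_emix_fun mY1 N0 finp finm) _ => //.
by apply: cvg1.
Qed.

End Transfer.

(** * Gamma integrals and powers of affine functions *)

Section GammaIntegral.
Context {R : realType}.
Local Notation mu := (@lebesgue_measure R).

Lemma lebesgue_measure_scale (s : R) (A : set (measurableTypeR R)) : 0 < s ->
  measurable A -> mu A = (s%:E * mu (( *%R s) @^-1` A))%E.
Proof.
move=> s0 mA.
have ms : measurable_fun [set: measurableTypeR R] ( *%R s : measurableTypeR R -> _).
  exact: measurable_funM.
pose k := NngNum (ltW s0).
unshelve epose (nu0 := (pushforward mu ( *%R s : measurableTypeR R -> measurableTypeR R)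
  : {measure set (measurableTypeR R) -> \bar R})); first exact: ms.
pose nu : {measure set (measurableTypeR R) -> \bar R} := mscale k nu0.
have -> : (s%:E * mu (( *%R s) @^-1` A))%E = nu A by [].
apply: lebesgue_measure_unique => //= _ [[a b]] _ <-.
rewrite /nu /mscale /= /pushforward.
rewrite (_ : _ @^-1` _ = `]a / s, b / s]%classic); last first.
  apply/seteqP; split => x /=; rewrite !in_itv/= ltr_pdivrMr// ler_pdivlMr//;
    by rewrite mulrC.
rewrite !lebesgue_measure_itv/= !lte_fin ltr_pM2r ?invr_gt0//.
case: ifPn => _; last by rewrite mule0.
by rewrite -!EFinD -EFinM -mulrBl mulrCA mulfV ?gt_eqF// mulr1.
Qed.

Lemma integral_scale (s : R) (f : R -> \bar R) : 0 < s ->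
  measurable_fun [set: R] f -> (forall x, 0 <= f x)%E ->
  (\int[mu]_x f (s * x)%R = s^-1%:E * \int[mu]_x f x)%E.
Proof.
move=> s0 mf f0.
have ms : measurable_fun [set: measurableTypeR R] ( *%R s : measurableTypeR R -> _).
  exact: measurable_funM.
pose k := NngNum (ltW s0).
unshelve epose (nu := (pushforward mu ( *%R s : measurableTypeR R -> measurableTypeR R)
  : {measure set (measurableTypeR R) -> \bar R})); first exact: ms.
have -> : (\int[mu]_x f (s * x)%R = \int[nu]_x f x)%E.
  by rewrite ge0_integral_pushforward.
have -> : (\int[mu]_x f x = s%:E * \int[nu]_x f x)%E.
  rewrite -(@ge0_integral_mscale _ _ _ nu _ measurableT k)//.
  apply: eq_measure_integral => A mA _.
  exact: lebesgue_measure_scale.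
by rewrite muleA -EFinM mulVf ?mul1e// gt_eqF.
Qed.

Lemma measurable_gamma_fun (a s : R) :
  measurable_fun [set: R] (fun t : R => t `^ (a - 1) * expR (- (s * t))).
Proof.
apply: measurable_funM; first exact: measurable_powR.
by apply: measurableT_comp => //; apply: measurableT_comp => //; exact: measurable_funM.
Qed.

Lemma integral_powR01 (a : R) : 0 < a ->
  (\int[mu]_(t in `]0%R, 1%R]) (t `^ (a - 1))%:E <= (a^-1)%:E)%E.
Proof.
move=> a0.
(* The integrand may blow up at 0, hence an exhaustion by intervals where the fundamental theorem of
   calculus applies to t^a/a; n + 2 makes the lower endpoint strictly less than 1. *)
pose F n : set R := `[n.+2%:R^-1, 1]%classic.
have -> : `]0%R, 1%R]%classic = \bigcup_n F n.
  apply/seteqP; split => x /=.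
    rewrite in_itv/= => /andP[x0 x1].
    exists (Num.truncn x^-1) => //; rewrite /F /= in_itv/= x1 andbT.
    rewrite -[leRHS]invrK lef_pV2 ?posrE ?invr_gt0//.
    by rewrite ltW// (lt_le_trans (truncnS_gt _))// ler_nat.
  move=> [n _]; rewrite /F /= !in_itv/= => /andP[h ->]; rewrite andbT.
  by apply: lt_le_trans h.
have ndF : nondecreasing_seq F.
  move=> m n mn; apply/subsetPset => x; rewrite /F /= !in_itv/= => /andP[h ->].
  by rewrite andbT (le_trans _ h)// lef_pV2 ?posrE// ler_nat !ltnS.
have mp : measurable_fun [set: R] (fun t : R => (t `^ (a - 1))%:E).
  by apply/measurable_EFinP; exact: measurable_powR.
have := @ge0_nondecreasing_set_cvg_integral _ (measurableTypeR R) R F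
  (fun t => (t `^ (a - 1))%:E) mu ndF.
have mF i : measurable (F i) by exact: measurable_itv.
move=> /(_ mF) /(_ (fun i => measurable_funTS mp)).
have p0 i x : F i x -> (0 <= (x `^ (a - 1))%:E)%E by rewrite lee_fin powR_ge0.
move=> /(_ p0) h.
rewrite -(cvg_lim _ h)//; apply: lime_le; first by apply/cvg_ex; eexists; exact: h.
apply: nearW => n.
have n1 : (n.+2%:R^-1 : R) < 1 by rewrite invf_lt1// ltr1n.
have n0 : 0 < (n.+2%:R^-1 : R) by [].
have dF (x : R) : 0 < x -> is_derive x 1 (fun t => a^-1 * t `^ a) (x `^ (a - 1)).
  move=> x0; have hd := @is_derive1_powR R a x x0.
  have := @is_deriveZ _ _ _ (fun t => t `^ a) a^-1 x 1 _ hd.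
  by rewrite /GRing.scale/= mulrA mulVf ?mul1r// gt_eqF.
have cF (x : R) : 0 < x -> {for x, continuous (fun t => a^-1 * t `^ a)}.
  move=> x0; apply/differentiable_continuous/derivable1_diffP.
  by have := dF _ x0; case.
rewrite (@continuous_FTC2 _ _ (fun t => a^-1 * t `^ a))//=.
- rewrite powR1 mulr1 -EFinB lee_fin gerBl mulr_ge0 ?powR_ge0// invr_ge0 ltW//.
- apply: derivable_within_continuous => x; rewrite in_itv/= => /andP[hx _].
  by apply: derivable_powR; rewrite in_itv/= andbT (lt_le_trans n0).
- split.
  + move=> x; rewrite in_itv/= => /andP[hx _].
    by have := dF _ (lt_trans n0 hx); case.
  + by apply: cvg_at_right_filter; exact: cF.
  + by apply: cvg_at_left_filter; exact: cF.
- move=> x; rewrite in_itv/= => /andP[hx _].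
  rewrite derive1E; have := dF _ (lt_trans n0 hx) => -[_ ->//].
Qed.

(** Up to 1 the integrand is at most t^(a - 1); beyond 1 half of the decay exp(-t) absorbs the power
    of t, and the other half is an exponential density of rate 1/2. *)
Lemma gamma_integral_lty (a : R) : 0 < a ->
  (\int[mu]_(t in `]0%R, +oo[) (t `^ (a - 1) * expR (- t))%:E < +oo)%E.
Proof.
move=> a0.
(* Thus a - 1 <= n + 1, and [C] comes from (t/2)^(n+1) / (n+1)! <= exp(t/2). The exponential density
   carries a factor 1/2, whence C * 2 below. *)
pose n := Num.truncn a.
pose C : R := 2 ^+ n.+1 * (n.+1)`!%:R.
have C0 : 0 <= C by rewrite mulr_ge0// exprn_ge0.
have bnd (t : R) : 1 < t -> t `^ (a - 1) * expR (- t) <= C * 2 * exponential_pdf 2^-1 t.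
  move=> t1.
  have t0 : 0 < t by exact: lt_trans t1.
  rewrite exponential_pdfE; last exact: ltW.
  have h1 : t `^ (a - 1) <= t ^+ n.+1.
    rewrite -powR_mulrn; last exact: ltW.
    apply: (ler_powR (ltW t1)).
    by apply: (@le_trans _ _ a); [rewrite gerBl|exact/ltW/truncnS_gt].
  have h2 : t ^+ n.+1 <= C * expR (t / 2).
    have := @expR_ge1Dxn R (t / 2) n _.
    rewrite divr_ge0 ?(ltW t0)// => /(_ isT) h.
    have : (t / 2) ^+ n.+1 / n.+1`!%:R <= expR (t / 2) by lra.
    rewrite ler_pdivrMr ?ltr0n ?fact_gt0// exprMn exprVn.
    rewrite ler_pdivrMr ?exprn_gt0// => h'; apply: (le_trans h').
    by rewrite /C [leRHS]mulrC -mulrA ler_wpM2l ?expR_ge0// mulrC.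
  rewrite mulrA -(mulrA C) mulfV ?mulr1//.
  apply: (@le_trans _ _ (C * expR (t / 2) * expR (- t))).
    by rewrite ler_wpM2r ?expR_ge0// (le_trans h1).
  rewrite -mulrA -expRD ler_wpM2l// ler_expR.
  lra.
have mg : measurable_fun [set: R] (fun t : R => (t `^ (a - 1) * expR (- t))%:E).
  apply/measurable_EFinP.
  by have := measurable_gamma_fun a 1; under eq_fun do rewrite mul1r.
have g0 (t : R) : (0 <= (t `^ (a - 1) * expR (- t))%:E)%E.
  by rewrite lee_fin mulr_ge0 ?powR_ge0 ?expR_ge0.
rewrite (_ : `]0%R, +oo[%classic = `]0%R, 1%R] `|` `]1%R, +oo[); last first.
  by rewrite -itv_bndbnd_setU ?bnd_simp.
rewrite ge0_integral_setU//=; last 2 first.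
- exact: measurable_funTS.
- by apply/disj_setPS => x /= []; rewrite !in_itv/= => /andP[_ h1]; rewrite andbT ltNge h1.
apply: lte_add_pinfty.
  apply: le_lt_trans (ltry a^-1); apply: le_trans (integral_powR01 a0).
  apply: ge0_le_integral => //.
  - exact: measurable_funTS.
  - by apply/measurable_EFinP/measurable_funTS; exact: measurable_powR.
  - move=> t /=; rewrite in_itv/= => /andP[t0 _]; rewrite lee_fin.
    by rewrite -[leRHS]mulr1 ler_wpM2l ?powR_ge0// -expR0 ler_expR lerNl oppr0 ltW.
have mexp : measurable_fun [set: R] (fun t : R => (C * 2 * exponential_pdf 2^-1 t)%:E).
  by apply/measurable_EFinP; apply: measurable_funM => //; exact: measurable_exponential_pdf.
have e0 (t : R) : (0 <= (exponential_pdf (2^-1 : R) t)%:E)%E.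
  by rewrite lee_fin exponential_pdf_ge0// invr_ge0.
apply: (@le_lt_trans _ _ (\int[mu]_(t in `]1%R, +oo[) (C * 2 * exponential_pdf 2^-1 t)%:E)%E).
  apply: ge0_le_integral => //; try exact: measurable_funTS.
  by move=> t /=; rewrite in_itv/= andbT => t1; rewrite lee_fin bnd.
apply: (@le_lt_trans _ _ (\int[mu]_t (C * 2 * exponential_pdf 2^-1 t)%:E)%E).
  apply: ge0_subset_integral => // t _; rewrite EFinM mule_ge0// lee_fin mulr_ge0//.
under eq_integral do rewrite EFinM.
rewrite ge0_integralZl//; last 2 first.
- by apply/measurable_EFinP; exact: measurable_exponential_pdf.
- by rewrite lee_fin mulr_ge0.
by rewrite integral_exponential_pdf// mule1 ltry.
Qed.

Lemma GammaE (a : R) : 0 < a ->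
  (\int[mu]_(t in `]0%R, +oo[) (t `^ (a - 1) * expR (- t))%:E = (Gamma a)%:E)%E.
Proof.
move=> a0; rewrite /Gamma /Rintegral fineK// ge0_fin_numE ?gamma_integral_lty//.
by apply: integral_ge0 => t _; rewrite lee_fin mulr_ge0 ?powR_ge0 ?expR_ge0.
Qed.

Lemma gamma_integral (a s : R) : 0 < a -> 0 < s ->
  (\int[mu]_(t in `]0%R, +oo[) (t `^ (a - 1) * expR (- (s * t)))%:E =
   (Gamma a * s `^ (- a))%:E)%E.
Proof.
move=> a0 s0; rewrite EFinM -GammaE//.
rewrite integral_mkcond [in RHS]integral_mkcond.
set g := (X in _ = (integral _ _ X * _)%E).
have mg : measurable_fun [set: R] g.
  apply/(measurable_restrictT _ _).1 => //; apply/measurable_EFinP/measurable_funTS.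
  by have := measurable_gamma_fun a 1; under eq_fun do rewrite mul1r.
have g0 t : (0 <= g t)%E.
  by apply: erestrict_ge0 => x _; rewrite lee_fin mulr_ge0 ?powR_ge0 ?expR_ge0.
have -> : (fun t : R => (t `^ (a - 1) * expR (- (s * t)))%:E) \_ `]0, +oo[
   = fun t => ((s `^ (1 - a))%:E * g (s * t)%R)%E.
  apply/funext => t; rewrite /g !patchE !mem_setE !in_itv/= !andbT.
  rewrite pmulr_rgt0//; case: ifPn => [t0|_]; last by rewrite mule0.
  rewrite -EFinM; congr EFin.
  rewrite powRM ?ltW// mulrA mulrA -powRD; last by rewrite (gt_eqF s0) implybT.
  by rewrite addrA subrK subrr powRr0 mul1r.
rewrite ge0_integralZl//; last 2 first.
- by apply: measurableT_comp => //; exact: measurable_funM.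
- by rewrite lee_fin powR_ge0.
rewrite integral_scale// muleA -EFinM muleC; congr (_ * _%:E)%E.
rewrite -powR_inv1 ?ltW// -powRD; last by rewrite (gt_eqF s0) implybT.
by rewrite addrAC subrr add0r.
Qed.

(** Gamma(a + k) outgrows every geometric sequence: on [M + 1, M + 2], t^k is at least M^k and, as t
    >= 1, t^a is at least 1. This makes the density series converge at every point of the orthant; M
    = k = 0 gives positivity of [Gamma]. *)
Lemma Gamma_ge (a M : R) k : 0 < a -> 0 <= M ->
  M ^+ k * ((M + 2)^-1 * expR (- (M + 2))) <= Gamma (a + k%:R).
Proof.
move=> a0 M0.
have ak0 : 0 < a + k%:R by rewrite ltr_wpDr.
rewrite -lee_fin -GammaE//.
have mg : measurable_fun [set: R] (fun t : R => (t `^ (a + k%:R - 1) * expR (- t))%:E).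
  apply/measurable_EFinP.
  by have := measurable_gamma_fun (a + k%:R) 1; under eq_fun do rewrite mul1r.
apply: (@le_trans _ _ (\int[mu]_(t in `[(M + 1)%R, (M + 2)%R]) (t `^ (a + k%:R - 1) * expR (- t))%:E)%E).
  apply: (@le_trans _ _ (\int[mu]_(t in `[(M + 1)%R, (M + 2)%R]) (cst (M ^+ k * ((M + 2)^-1 * expR (- (M + 2))))%R%:E) t)%E).
    rewrite integral_cst//= lebesgue_measure_itv/= lte_fin ltrD2l ltr1n.
    rewrite -EFinB -EFinM (_ : M + 2 - (M + 1) = 1) ?mulr1//; lra.
  apply: ge0_le_integral => //.
  - by move=> t _; rewrite lee_fin !mulr_ge0 ?exprn_ge0 ?invr_ge0 ?expR_ge0//; lra.
  - exact: measurable_funTS.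
  - move=> t /=; rewrite in_itv/= => /andP[t1 t2]; rewrite lee_fin.
    have t0 : 0 < t by lra.
    have -> : t `^ (a + k%:R - 1) = t ^+ k * (t `^ a / t).
      rewrite -powR_mulrn ?ltW// -powR_inv1 ?ltW// -!powRD ?(gt_eqF t0) ?implybT//.
      by congr (_ `^ _); ring.
    rewrite -!mulrA; apply: ler_pM.
    + exact: exprn_ge0.
    + by rewrite mulr_ge0 ?expR_ge0// invr_ge0; lra.
    + by apply: lerXn2r; rewrite ?nnegrE; lra.
    apply: (@le_trans _ _ (t^-1 * expR (- t))).
      apply: ler_pM; rewrite ?expR_ge0 ?invr_ge0 ?ler_expR ?lef_pV2 ?posrE//; lra.
    rewrite -[leLHS]mul1r ler_wpM2r// ?mulr_ge0 ?invr_ge0 ?expR_ge0 ?(ltW t0)//.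
    have t1' : 1 <= t by lra.
    by rewrite -(powRr0 t); apply: (ler_powR t1'); exact: ltW.
apply: ge0_subset_integral => //.
- exact: measurable_funTS.
- by move=> t _; rewrite lee_fin mulr_ge0 ?powR_ge0 ?expR_ge0.
- by move=> t /=; rewrite !in_itv/= andbT => /andP[h _]; lra.
Qed.

Lemma Gamma_gt0 (a : R) : 0 < a -> 0 < Gamma a.
Proof.
move=> a0; have := @Gamma_ge a 0 0 a0 (lexx _).
rewrite expr0 mul1r addr0 add0r; apply: lt_le_trans.
by rewrite mulr_gt0 ?expR_gt0// invr_gt0.
Qed.

End GammaIntegral.

Section AffinePower.
Context d (T : measurableType d) {R : realType}.
Variables (m : {measure set T -> \bar R}) (Y : T -> R).
Hypothesis mY : measurable_fun [set: T] Y.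
Variables (lambda A B e : R).
Hypotheses (lambda0 : 0 < lambda) (e0 : 0 < e).
Local Notation laplace t := (\int[m]_x (expR (- (t * Y x)))%:E)%E.
Hypothesis laplace_near : forall t, `|t| < e ->
  0 < A + B * t /\ laplace t = ((A + B * t) `^ (- lambda))%:E.

Let laplaceE t : laplace t = mgf m (fun x => - Y x) t.
Proof. by apply: eq_integral => x _; rewrite mulrN. Qed.

(** The right-hand side is the transform of B y under the unnormalized gamma weight y^(lambda - 1)
    exp(-A y) / Gamma(lambda), whatever the sign of B; [mgf_transfer] compares [m] with that
    measure. *)
Lemma laplace_affine_extend t : 0 < A + B * t ->
  laplace t = ((A + B * t) `^ (- lambda))%:E.
Proof.
pose mu := @lebesgue_measure R.
have mI : measurable (`]0%R, +oo[%classic : set R) by exact: measurable_itv.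
pose g (y : measurableTypeR R) : R :=
  \1_`]0%R, +oo[%classic y * ((Gamma lambda)^-1 * (y `^ (lambda - 1) * expR (- (A * y)))).
have G0 := Gamma_gt0 lambda0.
have mg : measurable_fun [set: measurableTypeR R] g.
  apply: measurable_funM => //; apply: measurable_funM => //.
  exact: measurable_gamma_fun.
have g0 y : 0 <= g y.
  by rewrite !mulr_ge0 ?invr_ge0 ?powR_ge0 ?expR_ge0// ltW.
have [m2 [_ m2E]] := density_measure mu mg g0.
pose Y2 (y : measurableTypeR R) := - (B * y).
have mY2 : measurable_fun [set: measurableTypeR R] Y2.
  by apply: measurableT_comp => //; exact: measurable_funM.
have mgf2 s : 0 < A + B * s -> mgf m2 Y2 s = ((A + B * s) `^ (- lambda))%:E.
  move=> As; rewrite /mgf m2E//; last exact/measurable_EFinP/measurable_mgf_fun.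
  transitivity (\int[mu]_(y in `]0%R, +oo[) ((Gamma lambda)^-1%:E *
      (y `^ (lambda - 1) * expR (- ((A + B * s) * y)))%:E))%E.
    rewrite [RHS]integral_mkcond; apply: eq_integral => y _.
    rewrite patchE /g indicE; case: ifPn => _; last by rewrite !mul0r mule0.
    rewrite mul1r -!EFinM; congr EFin.
    rewrite mulrCA (mulrCA (expR _)) -expRD; congr (_ * (_ * expR _)).
    by rewrite /Y2; ring.
  rewrite ge0_integralZl//=; last 3 first.
  - by apply/measurable_EFinP/measurable_funTS; exact: measurable_gamma_fun.
  - by move=> y _; rewrite lee_fin mulr_ge0 ?powR_ge0 ?expR_ge0.
  - by rewrite lee_fin invr_ge0 ltW.
  rewrite gamma_integral// -EFinM; congr EFin.
  by rewrite mulrA mulVf ?mul1r// gt_eqF.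
rewrite laplaceE => At.
(* Going from the center 0 straight to t would also need A - B t > 0, which may fail; the radius is
   doubled repeatedly instead. *)
suff ext n : forall t, 0 < A + B * t -> `|t| < 2 ^+ n * e ->
    mgf m (fun x => - Y x) t = ((A + B * t) `^ (- lambda))%:E.
  have te : `|t| / e < (Num.truncn (`|t| / e)).+1%:R by exact: truncnS_gt.
  apply: (ext (Num.truncn (`|t| / e)).+1 t) => //; rewrite -ltr_pdivrMr//.
  by apply: (lt_trans te); rewrite -natrX ltr_nat ltn_expl.
elim: n {t At} => [|n IHn] t At.
  by rewrite expr0 mul1r => /laplace_near[_ <-]; rewrite laplaceE.
move=> te.
have [t0|t0] := eqVneq t 0.
  by apply: IHn => //; rewrite t0 normr0 mulr_gt0// exprn_gt0.
have A0 : 0 < A.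
  by have [] := laplace_near (t := 0); rewrite ?normr0// mulr0 addr0.
(* Transfer from the center t / 2 with radius |t| / 2: both endpoints 0 and t lie
   in the domain of the gamma law. *)
have At2 : 0 < A + B * (t / 2) by lra.
have te2 : `|t / 2| < 2 ^+ n * e.
  rewrite normrM [ `|2^-1|]ger0_norm ?invr_ge0// ltr_pdivrMr//.
  by rewrite mulrAC -exprSr.
(* The first bound keeps A + B s positive, the second keeps s within the radius already reached; the
   + 1 covers B = 0. *)
pose e1 := Num.min ((A + B * (t / 2)) / (`|B| + 1)) (2 ^+ n * e - `|t / 2|).
have B1 : 0 < `|B| + 1 by rewrite ltr_wpDl.
have e10 : 0 < e1 by rewrite lt_min divr_gt0// subr_gt0.
have near s : `|s - t / 2| < e1 -> 0 < A + B * s /\ `|s| < 2 ^+ n * e.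
  rewrite lt_min ltr_pdivlMr// => /andP[h1 h2]; split; last first.
    have := ler_normD (s - t / 2) (t / 2); rewrite subrK; lra.
  have : `|B * (s - t / 2)| < A + B * (t / 2).
    apply: le_lt_trans h1; rewrite normrM mulrC ler_wpM2l// lerDl//.
  by rewrite ltr_norml => /andP[h _]; lra.
have ttE : t / 2 + t / 2 = t by lra.
have := @mgf_transfer _ T _ (measurableTypeR R) R m (fun x => - Y x) m2 Y2 _ mY2
  (t / 2) e1 _ _ (t / 2) _ _ e10.
rewrite ttE subrr mgf2// => -> //.
- exact: measurableT_comp.
- by move=> s /near[As se]; rewrite IHn// mgf2.
- by move=> s /near[As se]; rewrite mgf2// ltry.
- by rewrite ltry.
- by rewrite mgf2 ?mulr0 ?addr0// ltry.
Qed.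

(** Otherwise the segment from 0 to t has points where the affine function is positive but
    arbitrarily small, hence the transform arbitrarily large; yet on the segment it is at most
    laplace 0 + laplace t. *)
Lemma laplace_affine_gt0 t : (laplace t < +oo)%E -> 0 < A + B * t.
Proof.
move=> tfin; rewrite ltNge; apply/negP => At.
have A0 : 0 < A.
  by have [] := laplace_near (t := 0); rewrite ?normr0// mulr0 addr0.
have Bt : 0 < - (B * t) by lra.
have Bt0 : - (B * t) != 0 by rewrite gt_eqF.
have fin0 : (laplace 0 < +oo)%E.
  by have [] := laplace_near (t := 0); rewrite ?normr0// => _ ->; rewrite ltry.
have ms s : measurable_fun [set: T] (fun x => (expR (- (s * Y x)))%:E).
  apply/measurable_EFinP; apply: measurableT_comp => //.
  by apply: measurableT_comp => //; exact: measurable_funM.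
have pos s x : [set: T] x -> (0 <= (expR (- (s * Y x)))%:E)%E.
  by rewrite lee_fin expR_ge0.
have bnd s : 0 <= s <= 1 -> (laplace (s * t) <= laplace 0 + laplace t)%E.
  move=> /andP[s0 s1]; rewrite -ge0_integralD//.
  apply: ge0_le_integral => //; first exact: emeasurable_funD.
  move=> x _; rewrite -EFinD lee_fin mul0r oppr0 expR0.
  have [h|h] := leP 0 (t * Y x).
    apply: (@le_trans _ _ 1); last by rewrite lerDl expR_ge0.
    by rewrite -expR0 ler_expR oppr_le0 -mulrA mulr_ge0.
  apply: (@le_trans _ _ (expR (- (t * Y x)))); last by rewrite lerDr.
  by rewrite ler_expR lerN2 -mulrA -[leLHS]mul1r ler_wnM2r// ltW.
have : (laplace 0 + laplace t < +oo)%E by rewrite lte_add_pinfty.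
rewrite -ge0_fin_numE; last by rewrite adde_ge0// integral_ge0.
move=> /fineK; set M := fine _ => ME.
have M0 : 0 <= M by rewrite fine_ge0// adde_ge0// integral_ge0.
(* [a] is the value of the affine function at the point s t: small enough for a^(-lambda) >= M + 1,
   and at most A so that 0 <= s. *)
pose a := Num.min A ((M + 1) `^ (- lambda^-1)).
have a0 : 0 < a by rewrite lt_min A0 powR_gt0//; lra.
pose s := (A - a) / (- (B * t)).
have Ms : A + B * (s * t) = a.
  have : s * - (B * t) = A - a by rewrite /s divfK.
  by rewrite mulrN mulrCA => h; lra.
have s01 : 0 <= s <= 1.
  rewrite divr_ge0 ?(ltW Bt)//= ?ler_pdivrMr//; last by rewrite subr_ge0 ge_min lexx.
  by rewrite mul1r; lra.
have := bnd s s01; rewrite (laplace_affine_extend (t := s * t)) Ms// -ME lee_fin leNgt => /negP; apply.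
apply: (@lt_le_trans _ _ (M + 1)); first by rewrite ltrDl.
have M1 : 0 < M + 1 by lra.
have ab : a <= (M + 1) `^ (- lambda^-1) by rewrite ge_min lexx orbT.
rewrite powRN -[leLHS]invrK lef_pV2 ?posrE ?powR_gt0 ?invr_gt0//.
have -> : (M + 1)^-1 = ((M + 1) `^ (- lambda^-1)) `^ lambda.
  by rewrite -powRrM mulNr mulVf ?gt_eqF// powR_inv1 ?ltW.
apply: ge0_ler_powR => //; first exact: ltW.
- by rewrite nnegrE ltW.
- by rewrite nnegrE powR_ge0.
Qed.

End AffinePower.

(** * The domain of the Laplace transform *)

Section AffineAlgebra.
Context {R : realType} {n : nat}.
Implicit Types (p : {set 'I_n} -> R) (v : 'I_n -> R) (T : {set 'I_n}) (i : 'I_n).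

Definition coord_shift v i (t : R) : 'I_n -> R :=
  fun j => if j == i then v j + t else v j.

(* The coefficients of the partial derivative of [affine p] in direction [i]. *)
Definition dcoef p i T : R := if i \in T then 0 else p (i |: T)%SET.

Lemma big_set_split (F : {set 'I_n} -> R) i :
  \sum_T F T = \sum_(T : {set 'I_n} | i \notin T) (F T + F (i |: T)%SET).
Proof.
rewrite (bigID (fun T : {set 'I_n} => i \notin T))/= big_split/=; congr (_ + _).
rewrite (reindex_onto (fun T => i |: T)%SET (fun T => T :\ i)%SET)/=; last first.
  by move=> T; rewrite negbK => iT; rewrite finset.setD1K.
apply: eq_bigl => T; rewrite negbK setU11/=.
apply/eqP/idP => [<-|iT]; first by rewrite setD11.
by rewrite setU1K.
Qed.

Lemma affineE p v i : affine p v =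
  \sum_(T : {set 'I_n} | i \notin T)
    (p T + p (i |: T)%SET * v i) * \prod_(t in T) v t.
Proof.
rewrite /affine (big_set_split _ i); apply: eq_bigr => T iT.
by rewrite big_setU1//= mulrDl mulrA.
Qed.

Lemma affine_shift p v i t :
  affine p (coord_shift v i t) = affine p v + affine (dcoef p i) v * t.
Proof.
rewrite !(affineE _ _ i) mulr_suml -big_split/=; apply: eq_bigr => T iT.
rewrite /dcoef (negbTE iT) setU11 mul0r addr0 /coord_shift eqxx.
rewrite (eq_bigr v); first by ring.
by move=> j jT; case: eqP => // ji; rewrite -ji jT in iT.
Qed.

Lemma affine0 p : affine p (fun=> 0) = p finset.set0.
Proof.
rewrite /affine (bigD1 finset.set0)//= big_set0 mulr1 big1 ?addr0// => T T0.
have [t tT] : exists t, t \in T by apply/set0Pn.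
by rewrite (bigD1 t)//= mul0r mulr0.
Qed.

Lemma cvg_affine {U : Type} (F : set_system U) {FF : Filter F}
    p (w : U -> 'I_n -> R) v :
  (forall i, w s i @[s --> F] --> v i) -> affine p (w s) @[s --> F] --> affine p v.
Proof.
move=> wv; rewrite /affine.
apply: (@cvg_big R _ +%R) => [|T _]; first exact: add_continuous.
apply: cvgM; first exact: cvg_cst.
apply: (@cvg_big R _ *%R) => [|i _]; first exact: mul_continuous.
exact: wv.
Qed.

Lemma inner_shift v i t (x : 'I_n -> R) :
  inner (coord_shift v i t) x = inner v x + t * x i.
Proof.
rewrite /inner (bigD1 i)//= [in RHS](bigD1 i)//= /coord_shift eqxx mulrDl.
rewrite [in RHS]addrAC; congr (_ + _).
by apply: eq_bigr => j /negbTE ->.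
Qed.

End AffineAlgebra.

Section NonnegativeSupport.
Context d (T : measurableType d) {R : realType}.
Variables (m : {measure set T -> \bar R}) (Y : T -> R).
Hypothesis mY : measurable_fun [set: T] Y.

(** Let Y^- be the negative part. Since t Y^- <= exp(-t Y), t times the integral of Y^- g is at most
    K for every t >= 0, so this integral is 0. The weight [g] will be the exponential tilt at a
    point of finiteness. *)
Lemma ae_ge0_of_laplace_bounded (g : T -> R) (K : R) :
  measurable_fun [set: T] g -> (forall x, 0 < g x) ->
  (forall t : R, 0 <= t -> (\int[m]_x (expR (- (t * Y x)) * g x)%:E <= K%:E)%E) ->
  {ae m, forall x, 0 <= Y x}.
Proof.
move=> mg g0 bnd.
pose N x := Num.max (- Y x) 0.
have N0 x : 0 <= N x by rewrite le_max lexx orbT.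
have mN : measurable_fun [set: T] N by apply: measurable_maxr => //; exact: measurableT_comp.
have mNg : measurable_fun [set: T] (fun x => (N x * g x)%:E).
  by apply/measurable_EFinP; exact: measurable_funM.
have Ng0 x : [set: T] x -> (0 <= (N x * g x)%:E)%E.
  by rewrite lee_fin mulr_ge0// ltW.
have int0 : (\int[m]_x (N x * g x)%:E = 0)%E.
  have h t : 0 <= t -> (t%:E * \int[m]_x (N x * g x)%:E <= K%:E)%E.
    move=> t0; apply: le_trans (bnd t t0); rewrite -ge0_integralZl//.
    apply: ge0_le_integral => //.
    - by move=> x _; rewrite mule_ge0// lee_fin mulr_ge0// ltW.
    - exact: measurable_funeM.
    - apply/measurable_EFinP; apply: measurable_funM => //.
      by apply: measurableT_comp => //; apply: measurableT_comp => //; exact: measurable_funM.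
    move=> x _; rewrite -EFinM lee_fin mulrA ler_wpM2r ?(ltW (g0 x))//.
    rewrite /N; have [h|h] := leP (- Y x) 0; first by rewrite mulr0 expR_ge0.
    by apply: le_trans (expR_ge1Dx _); rewrite mulrN lerDr.
  have := h 1 ler01; rewrite mul1e => h1.
  have I0 : (0 <= \int[m]_x (N x * g x)%:E)%E by exact: integral_ge0.
  have If : (\int[m]_x (N x * g x)%:E)%E \is a fin_num.
    by rewrite ge0_fin_numE// (le_lt_trans h1)// ltry.
  move: I0 h; rewrite -(fineK If); set r := fine _; rewrite lee_fin => r0 h.
  apply/eqP; rewrite eqe eq_le r0 andbT leNgt; apply/negP => r1.
  have K0 : 0 <= K by have := h 0 (lexx 0); rewrite mul0e lee_fin.
  have := h ((K + 1) / r); rewrite -EFinM lee_fin divfK ?gt_eqF//.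
  rewrite divr_ge0 ?addr_ge0 ?(ltW r1)// => /(_ isT).
  by rewrite gerDl ler10.
have : ae_eq m setT (fun x => (N x * g x)%:E) (cst 0%E).
  apply/(ae_eq_integral_abs m measurableT mNg).
  by rewrite -[RHS]int0; apply: eq_integral => x _; rewrite gee0_abs// Ng0.
apply: filterS => x /(_ I) /= [] /eqP.
rewrite mulf_eq0 (gt_eqF (g0 x)) orbF /N => /eqP h.
have : - Y x <= Num.max (- Y x) 0 by rewrite le_max lexx.
by rewrite h oppr_le0.
Qed.

End NonnegativeSupport.

Lemma finite_pos_lbound (R : realDomainType) (n : nat) (f : 'I_n -> R) :
  (forall i, 0 < f i) -> exists2 d : R, 0 < d & forall i, d <= f i.
Proof.
move=> f0; exists (\big[Num.min/1]_i f i); first exact: lt_bigmin.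
by move=> i; exact: bigmin_le.
Qed.

Section LaplaceDomain.
Context {R : realType} {n : nat}.
Variables (gamma : {measure set (n.-tuple R) -> \bar R}).
Variables (p : {set 'I_n} -> R) (lambda : R).
Hypothesis lambda0 : 0 < lambda.
Implicit Types (u v w : 'I_n -> R) (i j : 'I_n).

Definition laplace v : \bar R :=
  (\int[gamma]_x (expR (- inner v (tnth x)))%:E)%E.

Lemma measurable_inner v : measurable_fun [set: n.-tuple R] (fun x => inner v (tnth x)).
Proof.
rewrite /inner; apply: measurable_sum => i; apply: measurable_funM => //.
exact: measurable_tnth.
Qed.

Lemma measurable_laplace_fun v :
  measurable_fun [set: n.-tuple R] (fun x => expR (- inner v (tnth x))).
Proof.
by apply: measurableT_comp => //; apply: measurableT_comp => //; exact: measurable_inner.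
Qed.

Definition laplace_eq v := 0 < affine p v /\
  laplace v = ((affine p v) `^ (- lambda))%:E.

Definition near_laplace_eq v := exists2 d : R, 0 < d &
  forall w, (forall j, `|w j - v j| < d) -> laplace_eq w.

Lemma laplace_shift v i t : laplace (coord_shift v i t) =
  (\int[gamma]_x (expR (- (t * tnth x i)) * expR (- inner v (tnth x)))%:E)%E.
Proof.
by apply: eq_integral => x _; rewrite inner_shift opprD addrC expRD.
Qed.

(** Tilting [gamma] by exp(- <v, x>) turns its transform along the i-th coordinate line through [v]
    into a one-variable transform of x_i, to which the results on powers of affine functions
    apply. *)
Lemma near_laplace_eq_line v i : near_laplace_eq v ->
  exists2 m : {measure set (n.-tuple R) -> \bar R},
    (forall t, laplace (coord_shift v i t) = \int[m]_x (expR (- (t * tnth x i)))%:E)%E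
    & exists2 d : R, 0 < d & forall t, `|t| < d ->
        0 < affine p v + affine (dcoef p i) v * t /\
        (\int[m]_x (expR (- (t * tnth x i)))%:E)%E =
        ((affine p v + affine (dcoef p i) v * t) `^ (- lambda))%:E.
Proof.
move=> [d d0 near_v].
have [m [_ mE]] := density_measure gamma (measurable_laplace_fun v)
  (fun x => expR_ge0 _).
have mi t : measurable_fun [set: n.-tuple R] (fun x => (expR (- (t * tnth x i)))%:E).
  apply/measurable_EFinP; apply: measurableT_comp => //.
  apply: measurableT_comp => //; apply: measurable_funM => //.
  exact: measurable_tnth.
have lE t : (laplace (coord_shift v i t) = \int[m]_x (expR (- (t * tnth x i)))%:E)%E.
  rewrite laplace_shift mE//.
exists m => //; exists d => // t td.
rewrite -lE -affine_shift; apply: near_v => j; rewrite /coord_shift.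
by case: eqP => _; [rewrite addrAC subrr add0r|rewrite subrr normr0].
Qed.

Lemma laplace_eq_shift v i t : near_laplace_eq v ->
  (laplace (coord_shift v i t) < +oo)%E -> laplace_eq (coord_shift v i t).
Proof.
move=> /(near_laplace_eq_line i)[m mE [d d0 md]].
have mi : measurable_fun [set: n.-tuple R] ((@tnth n R)^~ i) by exact: measurable_tnth.
rewrite mE => /(laplace_affine_gt0 mi lambda0 d0 md) h.
by split; rewrite ?mE affine_shift//; exact: (laplace_affine_extend mi lambda0 d0 md).
Qed.

(** A point near the shifted one is the i-shift of a point near [v], so the identity holds on a full
    neighborhood again and another coordinate can be moved next. *)
Lemma near_laplace_eq_shift v i t : near_laplace_eq v ->
  (exists2 d, 0 < d & forall w, (forall j, `|w j - coord_shift v i t j| < d) ->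
    (laplace w < +oo)%E) ->
  near_laplace_eq (coord_shift v i t).
Proof.
move=> [d d0 near_v] [e e0 fin_e].
exists (Num.min d e) => [|w wv]; first by rewrite lt_min d0.
have wE : w = coord_shift (coord_shift w i (- t)) i t.
  by apply/funext => j; rewrite /coord_shift; case: eqP => // _; rewrite subrK.
rewrite wE; apply: laplace_eq_shift; last first.
  by rewrite -wE; apply: fin_e => j; have := wv j; rewrite lt_min => /andP[].
have wv' j : `|coord_shift w i (- t) j - v j| < d.
  have := wv j; rewrite lt_min => /andP[+ _]; rewrite /coord_shift.
  by case: eqP => // _; rewrite opprD addrA addrAC.
have [|r r0 rw] := @finite_pos_lbound R n (fun j => d - `|coord_shift w i (- t) j - v j|).
  by move=> j; rewrite subr_gt0.
exists r => // u uw; apply: near_v => j.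
have := ler_normD (u j - coord_shift w i (- t) j) (coord_shift w i (- t) j - v j).
by have := uw j; have := rw j; rewrite addrA subrK; lra.
Qed.

(* The coordinates of [v] are replaced by those of [w] one at a time. *)
Lemma near_laplace_eq_box (s b v w : 'I_n -> R) :
  (forall j, `|s j| = 1) ->
  (forall u, (forall j, b j < s j * u j) -> (laplace u < +oo)%E) ->
  (forall j, b j < s j * v j) -> (forall j, b j < s j * w j) ->
  near_laplace_eq v -> near_laplace_eq w.
Proof.
move=> s1 fin bv bw near_v.
pose h k : 'I_n -> R := fun j => if (j < k)%N then w j else v j.
suff : near_laplace_eq (h n).
  by congr near_laplace_eq; apply/funext => j; rewrite /h ltn_ord.
have bh k j : b j < s j * h k j by rewrite /h; case: ifP.
suff H k : (k <= n)%N -> near_laplace_eq (h k) by exact: H.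
elim: k => [_|k IHk kn]; first exact: near_v.
pose i := Ordinal kn.
have hE : h k.+1 = coord_shift (h k) i (w i - v i).
  apply/funext => j; rewrite /h /coord_shift ltnS leq_eqVlt.
  have -> : (j == i) = (nat_of_ord j == k) by [].
  case: eqP => //= jk; rewrite jk ltnn.
  have -> : j = i by exact: val_inj.
  by rewrite addrC subrK.
rewrite hE; apply: near_laplace_eq_shift; first exact/IHk/ltnW.
rewrite -hE.
have [|r r0 rb] := @finite_pos_lbound R n (fun j => s j * h k.+1 j - b j).
  by move=> j; rewrite subr_gt0.
exists r => // u uh; apply: fin => j.
have : `|s j * (u j - h k.+1 j)| < r by rewrite normrM s1 mul1r.
by rewrite ltr_norml => /andP[+ _]; have := rb j; lra.
Qed.

Lemma laplace_le (s u v : 'I_n -> R) :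
  {ae gamma, forall x, forall j, 0 <= s j * tnth x j} ->
  (forall j, s j * s j = 1) ->
  (forall j, s j * u j <= s j * v j) -> (laplace v <= laplace u)%E.
Proof.
move=> aes s1 uv; apply: ae_ge0_le_integral => //.
- by apply/measurable_EFinP; exact: measurable_laplace_fun.
- by apply/measurable_EFinP; exact: measurable_laplace_fun.
apply: filterS aes => x xs _; rewrite lee_fin ler_expR lerN2.
apply: ler_sum => j _; have h2 := xs j.
have h1 : 0 <= s j * (v j - u j) by rewrite mulrBr subr_ge0.
rewrite -subr_ge0.
have -> : v j * tnth x j - u j * tnth x j =
    (s j * (v j - u j)) * (s j * tnth x j).
  by rewrite mulrACA s1 mul1r mulrBl.
by rewrite mulr_ge0.
Qed.

End LaplaceDomain.

Section PositiveOrthant.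
Context {R : realType} {n : nat}.
Variables (gamma : {measure set (n.-tuple R) -> \bar R}).
Variables (p : {set 'I_n} -> R) (lambda : R).
Hypotheses (lambda0 : 0 < lambda) (gamma_fin : (gamma setT < +oo)%E).
Hypotheses (p0 : p finset.set0 = 1) (pi0 : forall i, 0 < p [set i]%SET).
Variable theta : 'I_n -> R.
Hypothesis near_theta : near_laplace_eq gamma p lambda theta.

Let s j : R := if 0 <= affine (dcoef p j) theta then 1 else -1.

Let ss j : s j * s j = 1.
Proof. by rewrite /s; case: ifP => _; ring. Qed.

Let s1 j : `|s j| = 1.
Proof. by rewrite /s; case: ifP => _; rewrite ?normrN normr1. Qed.

(** From [theta], P does not decrease in the direction [s j] of the j-th axis, so the transform
    stays bounded by its value at [theta] under arbitrarily large shifts. *)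
Let sign_support : {ae gamma, forall x, forall j, 0 <= s j * tnth x j}.
Proof.
apply: filter_forall => j.
have [m mE [d d0 md]] := near_laplace_eq_line j near_theta.
have mj : measurable_fun [set: n.-tuple R] ((@tnth n R)^~ j) by exact: measurable_tnth.
set A := affine p theta in md; set B := affine (dcoef p j) theta in md.
have A0 : 0 < A by have [] := md 0; rewrite ?normr0// mulr0 addr0.
apply: (@ae_ge0_of_laplace_bounded _ _ _ gamma _ _
  (fun x => expR (- inner theta (tnth x))) (A `^ (- lambda))).
- exact: measurable_funM.
- exact: measurable_laplace_fun.
- by move=> x; exact: expR_gt0.
move=> t t0.
have Bs : 0 <= B * (s j * t).
  rewrite mulrA mulr_ge0// /s -/B; case: ifP => [B0|/negbT].
    by rewrite mulr1.
  by rewrite -ltNge => B0; rewrite mulrN1 oppr_ge0 ltW.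
have At : 0 < A + B * (s j * t) by rewrite ltr_wpDr.
have := laplace_affine_extend mj lambda0 d0 md At.
rewrite -mE laplace_shift => h.
under eq_integral do rewrite mulrCA mulrA.
rewrite h lee_fin !powRN lef_pV2 ?posrE ?powR_gt0//.
apply: ge0_ler_powR; rewrite ?nnegrE ?(ltW A0) ?(ltW At) ?(ltW lambda0)//.
by rewrite lerDl.
Qed.

Let laplace_sign v : (forall j, 0 < s j * v j) -> near_laplace_eq gamma p lambda v.
Proof.
have [d d0 near_d] := near_theta.
have fin0 u : (forall j, 0 <= s j * u j) -> (laplace gamma u < +oo)%E.
  move=> u0; apply: le_lt_trans (gamma_fin).
  have -> : (gamma setT = laplace gamma (fun=> 0)).
    rewrite /laplace -[LHS]mul1e -integral_cst//; apply: eq_integral => x _ /=.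
    by rewrite /inner big1 ?oppr0 ?expR0// => j _; rewrite mul0r.
  by apply: (laplace_le sign_support ss) => j; rewrite mulr0.
have fin1 u : (forall j, s j * theta j - d / 2 < s j * u j) ->
    (laplace gamma u < +oo)%E.
  move=> ud; apply: (@le_lt_trans _ _ (laplace gamma (fun j => theta j - s j * (d / 2)))).
    apply: (laplace_le sign_support ss) => j; rewrite mulrBr [X in _ - X]mulrA ss mul1r.
    exact/ltW/ud.
  have [_ ->] : laplace_eq gamma p lambda (fun j => theta j - s j * (d / 2)).
    apply: near_d => j; rewrite addrAC subrr add0r normrN normrM s1 mul1r.
    by rewrite gtr0_norm; lra.
  by rewrite ltry.
move=> v0.
(* [theta] need not lie in the orthant of the signs [s]. The point [w] lies in it and beyond
   [theta]: it is reached from [theta] in the box where [fin1] gives finiteness, and [v] is reached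
   from [w] in the orthant, where [fin0] does. *)
pose w j := s j * (Num.max (s j * theta j) 0 + 1).
have sw j : s j * w j = Num.max (s j * theta j) 0 + 1 by rewrite /w mulrA ss mul1r.
have w1 j : s j * theta j < s j * w j.
  have : s j * theta j <= Num.max (s j * theta j) 0 by rewrite le_max lexx.
  by rewrite sw; lra.
have w0 j : 0 < s j * w j.
  have : 0 <= Num.max (s j * theta j) 0 by rewrite le_max lexx orbT.
  by rewrite sw; lra.
apply: (near_laplace_eq_box lambda0 (s := s) (b := fun=> 0) (v := w)) => //.
  by move=> u u0; apply: fin0 => j; exact/ltW.
apply: (near_laplace_eq_box lambda0 (s := s) (b := fun j => s j * theta j - d / 2)
  (v := theta)) => //.
  by move=> j; lra.
by move=> j; apply: lt_trans (w1 j); lra.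
Qed.

Let s_pos i : s i = 1.
Proof.
have [//|si] : s i = 1 \/ s i = -1 by rewrite /s; case: ifP; [left|right].
(* The 2 makes P = 1 - 2 = -1 at [z]. If s_i = -1, [z] lies in the closed orthant of the signs [s],
   and [w e] approaches it through the open one, where P > 0. *)
pose t := - (2 / p [set i]%SET).
pose z : 'I_n -> R := coord_shift (fun=> 0) i t.
pose w (e : R) (j : 'I_n) := e * s j + z j.
have wpos e : 0 < e -> 0 <= affine p (w e).
  move=> e0; suff : near_laplace_eq gamma p lambda (w e).
    by case=> d d0 /(_ (w e)) []; [move=> j; rewrite subrr normr0|move=> /ltW].
  apply: laplace_sign => j; rewrite /w mulrDr mulrCA ss mulr1 ltr_wpDr//.
  rewrite /z /coord_shift; case: eqP => [->|_]; last by rewrite mulr0.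
  by rewrite si add0r /t mulrNN mul1r divr_ge0// ltW.
have zE : affine p z = -1.
  rewrite /z affine_shift !affine0 p0 /dcoef finset.in_set0 finset.setU0 /t.
  by field; rewrite gt_eqF.
have : affine p (w e) @[e --> 0^'+] --> affine p z.
  apply: cvg_affine => j; rewrite -[X in _ --> X]add0r -[X in _ --> X + _](mul0r (s j)).
  apply: cvgD; last exact: cvg_cst.
  by apply: cvgM; [exact: cvg_at_right_filter|exact: cvg_cst].
rewrite zE => h.
have : 0 <= -1 :> R.
  by apply: cvgr_to_ge h _; near=> e; apply: wpos.
by rewrite oppr_ge0 ler10.
Unshelve. all: by end_near. Qed.

Lemma laplace_positive_orthant :
  {ae gamma, forall x, forall j, 0 <= tnth x j} /\
  forall v, (forall j, 0 < v j) -> laplace_eq gamma p lambda v.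
Proof.
split.
  by apply: filterS sign_support => x xs j; have := xs j; rewrite s_pos mul1r.
move=> v v0; have [j|d d0] := @laplace_sign v; first by rewrite s_pos mul1r.
by apply => j; rewrite subrr normr0.
Qed.

End PositiveOrthant.

(** * Uniqueness of Laplace transforms *)

Section StepApproximation.
Context {R : realType}.

(* For large [m] this is about [expR (- m%:R * expR (m%:R * (c - x)))]. *)
Definition exp_step (c : R) (m : nat) (x : R) : R :=
  (1 - expR (- (m%:R * x))) ^+ Num.truncn (m%:R * expR (m%:R * c)).

Lemma exp_step_itv m (x : R) : 0 <= x -> 0 <= 1 - expR (- (m%:R * x)) <= 1.
Proof.
by move=> x0; rewrite subr_ge0 expR_le1 oppr_le0 mulr_ge0//= gerBl expR_ge0.
Qed.

(** Let u = exp(-m x) and N be the exponent. For c < x, Bernoulli gives the lower bound 1 - N u with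
    N u <= m exp(-m (x - c)). For x <= c, (1 - u)^N <= exp(-N u), where N u is at least m up to
    truncation. The factor m in N makes the limit 0 at x = c too, so no point is exceptional. *)
Lemma cvg_exp_step (c x : R) : 0 <= x ->
  exp_step c m.+1 x @[m --> \oo] --> ((c < x)%R%:R : R).
Proof.
move=> x0; have h := cvg_harmonic (R := R).
case: (ltP c x) => [cx|xc] /=.
  pose dl := x - c; have dl0 : 0 < dl by rewrite subr_gt0.
  apply: (@squeeze_cvgr _ _ _ _ (fun m => 1 - 2 / dl ^+ 2 * m.+1%:R^-1) (fun=> 1)).
  - apply: nearW => m; rewrite /exp_step; set N := Num.truncn _.
    have /andP[u0 u1] := exp_step_itv m.+1 x0.
    rewrite exprn_ile1 ?u0//= andbT.
    have := @bernoulli_ineq _ (- expR (- (m.+1%:R * x))) N.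
    rewrite lerN2 expR_le1 oppr_le0 mulr_ge0// => /(_ isT).
    apply: le_trans; rewrite lerD2l mulrN lerN2.
    have N1 : N%:R <= m.+1%:R * expR (m.+1%:R * c).
      by rewrite truncn_le mulr_ge0 ?expR_ge0.
    apply: (@le_trans _ _ (m.+1%:R * expR (m.+1%:R * c) * expR (- (m.+1%:R * x)))).
      by rewrite ler_wpM2r ?expR_ge0.
    rewrite -mulrA -expRD -mulrN -mulrDr.
    rewrite (_ : c - x = - dl); last by rewrite /dl opprB.
    rewrite mulrN expRN.
    have m0 : 0 < m.+1%:R :> R by [].
    have := @expR_ge1Dxn R (m.+1%:R * dl) 1%N.
    rewrite mulr_ge0 ?(ltW dl0)// => /(_ isT) e2.
    have e3 : (m.+1%:R * dl) ^+ 2 / 2 <= expR (m.+1%:R * dl).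
      by apply: le_trans e2; rewrite lerDr.
    have s0 : 0 < (m.+1%:R * dl) ^+ 2 / 2 by rewrite divr_gt0// exprn_gt0// mulr_gt0.
    apply: (@le_trans _ _ (m.+1%:R * ((m.+1%:R * dl) ^+ 2 / 2)^-1)).
      by rewrite ler_wpM2l// lef_pV2 ?posrE ?expR_gt0.
    rewrite le_eqVlt; apply/orP; left; apply/eqP; field.
    by rewrite (gt_eqF dl0) addrC natr1 gt_eqF.
  - rewrite [X in _ --> X](_ : _ = 1 - 2 / dl ^+ 2 * 0); last by rewrite mulr0 subr0.
    by apply: cvgB; [exact: cvg_cst|exact: cvgMr].
  - exact: cvg_cst.
apply: (@squeeze_cvgr _ _ _ _ (fun=> 0) (fun m => m.+1%:R^-1)) => //; last exact: cvg_cst.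
apply: nearW => m; rewrite /exp_step; set N := Num.truncn _.
have /andP[u0 u1] := exp_step_itv m.+1 x0.
rewrite exprn_ge0//=; set u := expR _ in u0 u1 *.
have uN : m%:R <= u * N%:R.
  have N1 : m.+1%:R * expR (m.+1%:R * c) < N.+1%:R by exact: truncnS_gt.
  have ux : u * expR (m.+1%:R * c) >= 1.
    rewrite /u -expRD -mulrN -mulrDr -expR0 ler_expR mulr_ge0//.
    by rewrite addrC subr_ge0.
  have : m.+1%:R <= u * N.+1%:R.
    apply: (@le_trans _ _ (u * (m.+1%:R * expR (m.+1%:R * c)))).
      by rewrite mulrCA ler_peMr.
    by rewrite ler_wpM2l ?expR_ge0 ?ltW.
  by rewrite -!natr1 mulrDr mulr1; have := u1; lra.
apply: (@le_trans _ _ (expR (- u) ^+ N)).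
  by apply: lerXn2r; rewrite ?nnegrE ?expR_ge0//; exact: expR_ge1Dx.
rewrite -expRM_natr mulNr expRN lef_pV2 ?posrE ?expR_gt0//.
apply: (@le_trans _ _ (expR m%:R)); last by rewrite ler_expR.
by rewrite -natr1 addrC expR_ge1Dx.
Qed.

End StepApproximation.

Section Boxes.
Context {R : realType} {n : nat}.

Definition upper_box (c : 'I_n -> R) : set (n.-tuple R) :=
  [set x | forall i, c i < tnth x i].

Definition upper_boxes : set (set (n.-tuple R)) :=
  [set A | exists c, A = upper_box c].

Lemma upper_boxI c1 c2 : upper_box c1 `&` upper_box c2 =
  upper_box (fun i => Num.max (c1 i) (c2 i)).
Proof.
apply/seteqP; split => x /=.
  by move=> [h1 h2] i; rewrite gt_max h1 h2.
by move=> h; split => i; have := h i; rewrite gt_max => /andP[].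
Qed.

Lemma measurable_upper_box c : measurable (upper_box c).
Proof.
rewrite (_ : upper_box c = \bigcap_(i in [set: 'I_n])
    ((@tnth n R)^~ i @^-1` `]c i, +oo[)).
  apply: fin_bigcap_measurable => // i _; rewrite -[X in measurable X]setTI.
  exact: measurable_tnth.
apply/seteqP; split=> x /= h i.
  by move=> _ /=; rewrite in_itv/= andbT; exact: h.
by have /= := h i I; rewrite in_itv/= andbT.
Qed.

Lemma upper_box_cover : \bigcup_k (upper_box (fun=> - k%:R)) = setT.
Proof.
apply/seteqP; split => // x _.
exists (Num.truncn (\sum_i `|tnth x i|)).+1 => // i.
rewrite ltrNl; apply: le_lt_trans (truncnS_gt _).
rewrite (le_trans (ler_norm _))// normrN.
by rewrite [leRHS](bigD1 i)//= lerDl sumr_ge0.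
Qed.

Lemma measurable_upper_boxes :
  @measurable _ (n.-tuple R) = <<s upper_boxes >>.
Proof.
apply/seteqP; split; last first.
  apply: smallest_sub.
    by split; [exact: measurable0|move=> A mA; rewrite setTD; exact: measurableC|
      exact: bigcupT_measurable].
  by move=> _ [c ->]; exact: measurable_upper_box.
apply: smallest_sub; first exact: smallest_sigma_algebra.
move=> A; rewrite -bigcup_seq => -[i _ [B mB <-]].
have : @measurable_fun _ _ (g_sigma_algebraType upper_boxes) R setT ((@tnth n R)^~ i).
  apply: (measurability _ (RGenOInfty.measurableE R)).
  move=> _ [_ [c ->] <-]; rewrite setTI.
  rewrite (_ : _ @^-1` _ = \bigcup_k (upper_box
     (fun j => if j == i then c else - k%:R))).
    by apply: bigcupT_measurable => k; apply: sub_sigma_algebra; eexists.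
  apply/seteqP; split => x /=; rewrite in_itv/= andbT.
    move=> cx; have : setT x by [].
    rewrite -upper_box_cover => -[k _ kx]; exists k => // j.
    by case: eqP => [->//|_]; exact: kx.
  by move=> [k _ /(_ i)]; rewrite eqxx.
by move=> /(_ measurableT B mB).
Qed.

End Boxes.

Section LaplaceUniqueness.
Context {R : realType} {n : nat}.
Local Notation T := (n.-tuple R).

Definition nonneg_orthant : set T := [set x | forall i, 0 <= tnth x i].

Lemma measurable_nonneg_orthant : measurable nonneg_orthant.
Proof.
rewrite (_ : nonneg_orthant = \bigcap_(i in [set: 'I_n])
    ((@tnth n R)^~ i @^-1` `[0, +oo[)).
  apply: fin_bigcap_measurable => // i _; rewrite -[X in measurable X]setTI.
  exact: measurable_tnth.
apply/seteqP; split=> x /= h i.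
  by move=> _ /=; rewrite in_itv/= andbT; exact: h.
by have /= := h i I; rewrite in_itv/= andbT.
Qed.

Local Notation D := nonneg_orthant.
Let mD := measurable_nonneg_orthant.

Section FiniteMeasures.
Variables mu nu : {measure set T -> \bar R}.
Hypotheses (mu_fin : (mu D < +oo)%E) (nu_fin : (nu D < +oo)%E).

Let test_integral (m : {measure set T -> \bar R}) (h : T -> R) (v : 'I_n -> R) :=
  (\int[m]_(x in D) (h x * expR (- inner v (tnth x)))%:E)%E.

(** Equality for all v >= 0, not only at v = 0, makes the class stable under multiplication by 1 -
    exp(-m x_i), which shifts v_i by m. Powers of these factors converge to indicators of
    half-spaces, whose products are indicators of boxes; the bound by 1 provides the domination. *)
Let test (h : T -> R) := [/\ measurable_fun [set: T] h,
  (forall x, D x -> 0 <= h x <= 1) &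
  forall v, (forall i, 0 <= v i) -> test_integral mu h v = test_integral nu h v].

Let kernel_itv v x : (forall i, 0 <= v i) -> D x -> 0 <= expR (- inner v (tnth x)) <= 1.
Proof.
move=> v0 Dx; rewrite expR_ge0 expR_le1 oppr_le0.
by apply: sumr_ge0 => i _; rewrite mulr_ge0//; exact: Dx.
Qed.

Let measurable_test (h : T -> R) v : measurable_fun [set: T] h ->
  measurable_fun D (fun x => (h x * expR (- inner v (tnth x)))%:E).
Proof.
move=> mh; apply: measurable_funTS; apply/measurable_EFinP.
by apply: measurable_funM => //; exact: measurable_laplace_fun.
Qed.

Let test_bound (h : R) v x : (0 <= h <= 1) -> (forall i, 0 <= v i) -> D x ->
  `|h * expR (- inner v (tnth x))| <= 1.
Proof.
move=> /andP[h0 h1] v0 Dx; have /andP[e0 e1] := kernel_itv v0 Dx.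
by rewrite ger0_norm ?mulr_ge0// mulr_ile1.
Qed.

Let integrable_test (m : {measure set T -> \bar R}) (h : T -> R) v : (m D < +oo)%E ->
  measurable_fun [set: T] h -> (forall x, D x -> 0 <= h x <= 1) ->
  (forall i, 0 <= v i) ->
  m.-integrable D (fun x => (h x * expR (- inner v (tnth x)))%:E).
Proof.
move=> mfin mh h01 v0.
apply: (@measurable_bounded_integrable _ _ _ _ (fun x => h x * expR (- inner v (tnth x)))) => //.
  by apply/measurable_EFinP; exact: measurable_test.
exists 1; split => // M M1 x Dx; apply: le_trans (ltW M1).
by apply: test_bound => //; exact: h01.
Qed.

Let test_mul_exp h (m : nat) i : test h ->
  test (fun x => h x * (1 - expR (- (m%:R * tnth x i)))).
Proof.
move=> [mh h01 hE]; split.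
- apply: measurable_funM => //; apply: measurable_funB => //.
  apply: measurableT_comp => //; apply: measurableT_comp => //.
  by apply: measurable_funM => //; exact: measurable_tnth.
- move=> x Dx; have /andP[h0 h1] := h01 x Dx.
  have /andP[e0 e1] := exp_step_itv m (Dx i).
  by rewrite mulr_ge0//= mulr_ile1.
move=> v v0.
pose v' := coord_shift v i m%:R.
have v'0 j : 0 <= v' j by rewrite /v' /coord_shift; case: eqP; rewrite ?addr_ge0.
have E (k : {measure set T -> \bar R}) : (k D < +oo)%E ->
    test_integral k (fun x => h x * (1 - expR (- (m%:R * tnth x i)))) v =
    (test_integral k h v - test_integral k h v')%E.
  move=> kfin; rewrite /test_integral -integralB//; [|exact: integrable_test..].
  apply: eq_integral => x _; rewrite -EFinB; congr EFin.
  by rewrite /v' inner_shift opprD expRD; ring.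
by rewrite !E// !hE.
Qed.

Let test_mul_expX h m i k : test h ->
  test (fun x => h x * (1 - expR (- (m%:R * tnth x i))) ^+ k).
Proof.
move=> th; elim: k => [|k IHk].
  by under eq_fun do rewrite expr0 mulr1.
by under eq_fun do rewrite exprSr mulrA; exact: test_mul_exp.
Qed.

Let test_mul_indic h c i : test h -> test (fun x => h x * (c < tnth x i)%R%:R).
Proof.
move=> th; have [mh h01 hE] := th.
have mi : measurable_fun [set: T] ((@tnth n R)^~ i) by exact: measurable_tnth.
have mind : measurable_fun [set: T] (fun x => h x * (c < tnth x i)%R%:R).
  apply: measurable_funM => //.
  rewrite (_ : (fun x => _) = \1_((@tnth n R)^~ i @^-1` `]c, +oo[)); last first.
    apply/funext => x; rewrite indicE; congr ((nat_of_bool _)%:R).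
    by apply/idP/idP; rewrite inE/= in_itv/= andbT.
  by apply: measurable_indic; rewrite -[X in measurable X]setTI; exact: mi.
split => //.
  move=> x Dx; have /andP[h0 h1] := h01 x Dx.
  by rewrite mulr_ge0//=; case: (_ < _)%R; rewrite ?mulr1 ?mulr0.
move=> v v0.
pose f m x := h x * exp_step c m.+1 (tnth x i).
have tf m : test (f m) by exact: test_mul_expX.
have cvgE (k : {measure set T -> \bar R}) : (k D < +oo)%E ->
    test_integral k (f m) v @[m --> \oo] -->
    test_integral k (fun x => h x * (c < tnth x i)%R%:R) v.
  move=> kfin.
  have := @dominated_convergence _ _ _ k D mD
    (fun m x => (f m x * expR (- inner v (tnth x)))%:E)
    (fun x => (h x * (c < tnth x i)%R%:R * expR (- inner v (tnth x)))%:E)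
    (fun x => 1%E).
  case.
  - by move=> m; have [mf _ _] := tf m; exact: measurable_test.
  - exact: measurable_test.
  - apply: aeW => x Dx; apply: cvg_EFin; first exact: nearW.
    apply: cvgM; last exact: cvg_cst.
    apply: cvgM; first exact: cvg_cst.
    by apply: cvg_exp_step; exact: Dx.
  - apply/integrableP; split => //.
    under eq_integral do rewrite /= normr1.
    by rewrite integral_cst// mul1e.
  - apply: aeW => x m Dx; rewrite lee_fin.
    by have [_ f01 _] := tf m; apply: test_bound => //; exact: f01.
  - by [].
have := cvgE mu mu_fin; have := cvgE nu nu_fin.
have -> : (fun m => test_integral mu (f m) v) = (fun m => test_integral nu (f m) v).
  by apply/funext => m; have [_ _ ->] := tf m.
by move=> cvg1 cvg2; apply: cvg_unique cvg2 cvg1.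
Qed.

Lemma laplace_unique_finite A : measurable A ->
  (forall v, (forall i, 0 <= v i) ->
    (\int[mu]_(x in D) (expR (- inner v (tnth x)))%:E =
     \int[nu]_(x in D) (expR (- inner v (tnth x)))%:E)%E) ->
  mu (A `&` D) = nu (A `&` D).
Proof.
move=> mA munu.
have test1 : test (fun=> 1).
  split => //; first by move=> x _; rewrite ler01 lexx.
  have E (m : {measure set T -> \bar R}) v : test_integral m (fun=> 1) v =
      (\int[m]_(x in D) (expR (- inner v (tnth x)))%:E)%E.
    by apply: eq_integral => x _; rewrite mul1r.
  by move=> v /munu; rewrite !E.
have test_box (c : 'I_n -> R) (r : seq 'I_n) :
    test (fun x => \prod_(i <- r) (c i < tnth x i)%R%:R).
  elim: r => [|i r IHr]; first by under eq_fun do rewrite big_nil.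
  by under eq_fun do rewrite big_cons mulrC; exact: test_mul_indic.
have boxE (m : {measure set T -> \bar R}) (c : 'I_n -> R) :
    m (upper_box c `&` D) =
    test_integral m (fun x => \prod_(i < n) (c i < tnth x i)%R%:R) (fun=> 0).
  rewrite /test_integral -[LHS]mul1e -integral_cst; last first.
    by apply: measurableI => //; exact: measurable_upper_box.
  rewrite integral_mkcondl; apply: eq_integral => x _.
  have -> : inner (fun=> 0) (tnth x) = 0.
    by rewrite /inner big1// => i _; rewrite mul0r.
  rewrite oppr0 expR0 mulr1.
  rewrite patchE; case: ifPn => [|xc].
    by rewrite inE => xc; rewrite big1// => i _; rewrite xc.
  have [i ci] : exists i, ~~ (c i < tnth x i)%R.
    by apply/existsP; rewrite -negb_forall; apply: contra xc => /forallP xc; rewrite inE.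
  by rewrite (bigD1 i)//= (negbTE ci) mul0r.
pose m1 : {measure set T -> \bar R} := mrestr mu mD.
pose m2 : {measure set T -> \bar R} := mrestr nu mD.
apply: (@measure_unique _ R T upper_boxes (fun k => upper_box (fun=> - k%:R))
  measurable_upper_boxes _ _ upper_box_cover m1 m2) => //.
- by move=> _ _ [c1 ->] [c2 ->]; eexists; exact: upper_boxI.
- by move=> k; eexists.
- move=> _ [c ->]; rewrite /m1 /m2 /mrestr /= /mrestr !boxE.
  by have [_ _ ->] := test_box c (index_enum 'I_n).
- move=> k; rewrite /m1 /= /mrestr; apply: le_lt_trans mu_fin.
  apply: le_measure; rewrite ?inE//; apply: measurableI => //.
  exact: measurable_upper_box.
Qed.

End FiniteMeasures.

(** Tilting by exp(-M sum_i x_i) makes both measures finite on the orthant and moves the parameters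
    v >= M to v >= 0; the inverse tilt then recovers [mu] and [nu]. *)
Lemma laplace_unique (mu nu : {measure set T -> \bar R}) (M : R) A :
  measurable A ->
  (forall v, (forall i, M <= v i) ->
    (\int[mu]_(x in D) (expR (- inner v (tnth x)))%:E =
     \int[nu]_(x in D) (expR (- inner v (tnth x)))%:E)%E) ->
  (\int[mu]_(x in D) (expR (- inner (fun=> M) (tnth x)))%:E < +oo)%E ->
  mu (A `&` D) = nu (A `&` D).
Proof.
move=> mA munu fin.
pose g (x : T) : R := expR (- inner (fun=> M) (tnth x)).
have mg : measurable_fun [set: T] g by exact: measurable_laplace_fun.
have g0 x : 0 <= g x by exact: expR_ge0.
have [m1 [m1A m1E]] := density_measure mu mg g0.
have [m2 [m2A m2E]] := density_measure nu mg g0.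
have m12 := munu (fun=> M) (fun=> lexx M).
have m1fin : (m1 D < +oo)%E by rewrite m1A.
have m2fin : (m2 D < +oo)%E by rewrite m2A// -m12.
have mV v : measurable_fun [set: T] (fun x => (expR (- inner v (tnth x)))%:E).
  by apply/measurable_EFinP; exact: measurable_laplace_fun.
have eq12 B : measurable B -> m1 (B `&` D) = m2 (B `&` D).
  move=> mB; apply: laplace_unique_finite => // v v0.
  rewrite m1E// m2E//.
  have E x : ((expR (- inner v (tnth x)))%:E * (g x)%:E)%E =
      (expR (- inner (fun i => v i + M) (tnth x)))%:E.
    rewrite -EFinM -expRD -opprD; congr ((expR (- _))%:E).
    by rewrite /inner -big_split/=; apply: eq_bigr => i _; rewrite mulrDl.
  under eq_integral do rewrite E; under [RHS]eq_integral do rewrite E.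
  by apply: munu => i; rewrite lerDr.
have mh : measurable_fun [set: T] (fun x => (expR (inner (fun=> M) (tnth x)))%:E).
  by apply/measurable_EFinP; apply: measurableT_comp => //; exact: measurable_inner.
have mAD : measurable (A `&` D) by exact: measurableI.
have untilt (m m' : {measure set T -> \bar R}) :
   (forall h : T -> \bar R, measurable_fun [set: T] h -> (forall x, 0 <= h x)%E ->
      forall D0, measurable D0 ->
        (\int[m']_(x in D0) h x = \int[m]_(x in D0) (h x * (g x)%:E))%E) ->
   m (A `&` D) = (\int[m']_(x in A `&` D) (expR (inner (fun=> M) (tnth x)))%:E)%E.
  move=> ->//; rewrite -[LHS]mul1e -integral_cst//; apply: eq_integral => x _ /=.
  by rewrite -EFinM -expRD subrr expR0.
rewrite (untilt _ _ m1E) (untilt _ _ m2E).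
apply: eq_measure_integral => B mB BAD.
by rewrite -(setIidl (_ : B `<=` D)) ?eq12// => x /BAD[].
Qed.

End LaplaceUniqueness.

(** * Transform of the series density *)

Section EsumCountable.
Context {R : realType} {I : countType}.
Local Open Scope ereal_scope.

(** Turns a sum over multi-indices into a series over nat, which can be integrated term by term;
    integers that code no index contribute 0. *)
Lemma esum_pickle (f : I -> \bar R) : (forall i, 0 <= f i) ->
  \esum_(i in [set: I]) f i = \sum_(k <oo) oapp f 0 (pickle_inv k).
Proof.
move=> f0; set F := fun k : nat => oapp f 0 (pickle_inv k).
have F0 k : 0 <= F k by rewrite /F; case: pickle_inv => //= i.
rewrite (nneseries_esumT F0).
have -> : \esum_(k in [set: nat]) F k = \esum_(k in @pickle I @` [set: I]) F k.
  rewrite [RHS]esum_mkcond; apply: eq_esum => k _; case: ifPn => // /negP kI.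
  rewrite /F; case E : pickle_inv => [i|]//=; exfalso; apply: kI; rewrite inE.
  by exists i => //; have := @pickle_invK I k; rewrite E.
rewrite esum_image; last by move=> i j _ _; exact: (pcan_inj pickleK).
by apply: eq_esum => i _; rewrite /F pickleK_inv.
Qed.

Context d (T : measurableType d) (mu : {measure set T -> \bar R}).
Variables (D : set T) (f : I -> T -> \bar R).
Hypotheses (mD : measurable D) (mf : forall i, measurable_fun D (f i)).
Hypothesis f0 : forall i x, 0 <= f i x.

Let F k x := oapp (f ^~ x) 0 (@pickle_inv I k).

Let mF k : measurable_fun D (F k).
Proof.
rewrite /F; case: pickle_inv => [i|] /=; first exact: mf.
exact: measurable_cst.
Qed.

Let F0 k x : 0 <= F k x.
Proof. by rewrite /F; case: pickle_inv => //= i. Qed.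

Let FE : (fun x => \esum_(i in [set: I]) f i x) = (fun x => \sum_(k <oo) F k x).
Proof. by apply/funext => x; rewrite esum_pickle. Qed.

Lemma measurable_esum : measurable_fun D (fun x => \esum_(i in [set: I]) f i x).
Proof. by rewrite FE; exact: ge0_emeasurable_sum. Qed.

Lemma integral_esum : \int[mu]_(x in D) (\esum_(i in [set: I]) f i x) =
  \esum_(i in [set: I]) \int[mu]_(x in D) f i x.
Proof.
rewrite esum_pickle; last by move=> i; exact: integral_ge0.
rewrite FE integral_nneseries//; congr (limn _); apply/funext => m.
apply: eq_bigr => k _; rewrite /F; case: pickle_inv => //=.
by rewrite integral0.
Qed.

End EsumCountable.

Section LebesgueProduct.
Context {R : realType}.

Lemma integral_leb_prod n (g : 'I_n -> R -> R) :
  (forall i, measurable_fun [set: R] (g i)) -> (forall i y, 0 <= g i y) ->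
  (\int[leb n]_x (\prod_(i < n) g i (tnth x i))%:E =
   \prod_(i < n) \int[@lebesgue_measure R]_y (g i y)%:E)%E.
Proof.
elim: n g => [|n IHn] g mg g0.
  rewrite big_ord0 /=.
  have -> : (fun x : 0.-tuple R => (\prod_(i < 0) g i (tnth x i))%:E) = cst 1%E.
    by apply/funext => x; rewrite big_ord0.
  by rewrite integral_dirac// diracT mul1e.
have mprod k (h : 'I_k -> R -> R) : (forall i, measurable_fun [set: R] (h i)) ->
    measurable_fun [set: k.-tuple R] (fun x => (\prod_(i < k) h i (tnth x i))%:E).
  move=> mh; apply/measurable_EFinP; apply: measurable_prod => i _.
  by apply: measurableT_comp => //; exact: measurable_tnth.
have -> : (\int[leb n.+1]_x (\prod_(i < n.+1) g i (tnth x i))%:E =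
  \int[(@lebesgue_measure R \x leb n)%E]_z
    ((g ord0 z.1)%:E * (\prod_(i < n) g (lift ord0 i) (tnth z.2 i))%:E))%E.
  unshelve epose (m := (pushforward (@lebesgue_measure R \x leb n)%E (@tuple_consp R n)
    : {measure set (n.+1.-tuple R) -> \bar R})); first exact: measurable_tuple_consp.
  transitivity (\int[m]_x (\prod_(i < n.+1) g i (tnth x i))%:E)%E.
    by apply: eq_measure_integral => A mA _.
  rewrite ge0_integral_pushforward//.
  - apply: eq_integral => -[y t] _ /=; rewrite big_ord_recl EFinM; congr (_ * _%:E)%E.
    by apply: eq_bigr => i _; rewrite tnthS.
  - exact: measurable_tuple_consp.
  - exact: mprod.
  - by move=> x _; rewrite lee_fin prodr_ge0.
rewrite fubini_tonelli1; last 2 first.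
- apply: emeasurable_funM.
    by apply/measurable_EFinP; exact: (measurableT_comp (mg ord0) measurable_fst).
  exact: (measurableT_comp (mprod n (fun i => g (lift ord0 i)) (fun i => mg _))
    measurable_snd).
- by move=> z; rewrite mule_ge0// lee_fin// prodr_ge0.
rewrite /fubini_F /= big_ord_recl -IHn//.
rewrite -ge0_integralZr//; last 3 first.
- by apply/measurable_EFinP; exact: mg.
- by move=> y _; rewrite lee_fin.
- by apply: integral_ge0 => x _; rewrite lee_fin prodr_ge0.
apply: eq_integral => y _; rewrite ge0_integralZl//.
- exact: (mprod n (fun i => g (lift ord0 i)) (fun i => mg _)).
- by move=> x _; rewrite lee_fin prodr_ge0.
- by rewrite lee_fin.
Qed.

End LebesgueProduct.

Lemma esumZl (R : realType) (I : countType) (r : R) (f : I -> \bar R) :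
  0 <= r -> (forall i, 0 <= f i)%E ->
  (\esum_(i in [set: I]) (r%:E * f i) = r%:E * \esum_(i in [set: I]) f i)%E.
Proof.
move=> r0 f0; rewrite !esum_pickle//; last by move=> i; rewrite mule_ge0// lee_fin.
rewrite -nneseriesZl; last by move=> k _; case: pickle_inv => //= i.
by apply: eq_eseriesr => k _; case: pickle_inv => //=; rewrite mule0.
Qed.

Lemma powR_prod (R : realType) (I : Type) (s : seq I) (x : I -> R) (r : R) :
  (forall i, 0 <= x i) -> (\prod_(i <- s) x i) `^ r = \prod_(i <- s) x i `^ r.
Proof.
move=> x0; elim: s => [|i s IHs]; first by rewrite !big_nil powR1.
by rewrite !big_cons powRM ?IHs// prodr_ge0.
Qed.

Section GammaSeriesDensity.
Context {R : realType} {n : nat}.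
Variables (lambda K : R) (a : 'I_n -> R) (b : {ffun 'I_n -> nat} -> R).
Hypotheses (lambda0 : 0 < lambda) (K0 : 0 <= K) (b0 : forall alpha, 0 <= b alpha).

Lemma mpoch_gt0 (alpha : {ffun 'I_n -> nat}) : 0 < mpoch lambda alpha.
Proof.
by apply: prodr_gt0 => i _; rewrite divr_gt0 ?Gamma_gt0// ltr_wpDr.
Qed.

Definition gamma_series (x : n.-tuple R) : \bar R :=
  \esum_(alpha in [set: {ffun 'I_n -> nat}])
    (b alpha / mpoch lambda alpha * monom alpha (tnth x))%:E.

Definition gamma_series_density (x : n.-tuple R) : R :=
  K * expR (inner a (tnth x)) * (\prod_(i < n) tnth x i) `^ (lambda - 1) *
  fine (gamma_series x) * \1_(@pos_orthant R n) x.

Hypothesis gamma_series_lty : forall x, pos_orthant x -> (gamma_series x < +oo)%E.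

Let factor (v : 'I_n -> R) (alpha : {ffun 'I_n -> nat}) (i : 'I_n) (y : R) : R :=
  \1_`]0, +oo[ y * (y `^ (lambda + (alpha i)%:R - 1) * expR (- ((v i - a i) * y))).

Let factor_ge0 v alpha i y : 0 <= factor v alpha i y.
Proof. by rewrite /factor !mulr_ge0 ?powR_ge0 ?expR_ge0. Qed.

Let measurable_factor v alpha i : measurable_fun [set: R] (factor v alpha i).
Proof.
apply: measurable_funM; last exact: measurable_gamma_fun.
exact: measurable_indic.
Qed.

Let term v alpha (x : n.-tuple R) : \bar R :=
  (K * (b alpha / mpoch lambda alpha) * \prod_(i < n) factor v alpha i (tnth x i))%:E.

Let term_ge0 v alpha x : (0 <= term v alpha x)%E.
Proof.
by rewrite lee_fin !mulr_ge0 ?prodr_ge0// invr_ge0 ltW// mpoch_gt0.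
Qed.

Let measurable_prod_factor v alpha : measurable_fun [set: n.-tuple R]
  (fun x => (\prod_(i < n) factor v alpha i (tnth x i))%:E).
Proof.
apply/measurable_EFinP; apply: measurable_prod => i _.
exact: (measurableT_comp (measurable_factor v alpha i) (measurable_tnth i)).
Qed.

Let measurable_term v alpha : measurable_fun [set: n.-tuple R] (term v alpha).
Proof.
have -> : term v alpha = (fun x => (K * (b alpha / mpoch lambda alpha))%:E *
    (\prod_(i < n) factor v alpha i (tnth x i))%:E)%E.
  by apply/funext => x; rewrite -EFinM.
exact: measurable_funeM.
Qed.

(** Once the prefactor is distributed, each term is a constant times a product of one-variable gamma
    integrands. Off the positive orthant both sides vanish, thanks to the indicator in each
    [factor]. The case v = 0 yields measurability and nonnegativity of the density. *)
Lemma gamma_series_densityE v x :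
  (gamma_series_density x * expR (- inner v (tnth x)))%:E =
  \esum_(alpha in [set: {ffun 'I_n -> nat}]) term v alpha x.
Proof.
rewrite /gamma_series_density indicE; case: (boolP (x \in _)) => [|xpos].
  rewrite inE => xpos; rewrite mulr1.
  set k := K * _ * _.
  have k0 : 0 <= k by rewrite !mulr_ge0 ?expR_ge0 ?powR_ge0.
  have series0 alpha : (0 <= (b alpha / mpoch lambda alpha * monom alpha (tnth x))%:E)%E.
    rewrite lee_fin !mulr_ge0 ?invr_ge0 ?(ltW (mpoch_gt0 _))//.
    by apply: prodr_ge0 => i _; rewrite exprn_ge0// ltW// xpos.
  rewrite mulrAC EFinM fineK; last first.
    by rewrite ge0_fin_numE ?gamma_series_lty//; exact: esum_ge0.
  rewrite /gamma_series -esumZl//; last by rewrite mulr_ge0 ?expR_ge0.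
  apply: eq_esum => alpha _; rewrite -EFinM; congr EFin.
  rewrite /k /monom.
  have -> : \prod_(i < n) factor v alpha i (tnth x i) =
     (\prod_(i < n) tnth x i `^ (lambda - 1)) * (\prod_(i < n) tnth x i ^+ alpha i) *
     (expR (inner a (tnth x)) * expR (- inner v (tnth x))).
    rewrite -expRD -big_split/= /inner -sumrB expR_sum -big_split/=.
    apply: eq_bigr => i _; rewrite /factor indicE mem_set ?mul1r; last first.
      by rewrite /= in_itv/= andbT xpos.
    rewrite -powR_mulrn ?(ltW (xpos i))// -powRD; last by rewrite (gt_eqF (xpos i)) implybT.
    by rewrite mulrBl opprB; congr (_ `^ _ * _); ring.
  by rewrite powR_prod; [ring|move=> i; exact/ltW/xpos].
rewrite mulr0 mul0r esum1// => alpha _.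
have [i xi] : exists i, ~~ (0 < tnth x i).
  apply/existsP; rewrite -negb_forall; apply: contra xpos => /forallP xpos.
  by rewrite inE.
rewrite /term (bigD1 i)//= /factor indicE memNset ?mul0r ?mulr0//=.
by rewrite in_itv/= andbT; apply/negP.
Qed.

Lemma measurable_gamma_series_density :
  measurable_fun [set: n.-tuple R] gamma_series_density.
Proof.
apply/measurable_EFinP.
have -> : EFin \o gamma_series_density =
    fun x => \esum_(alpha in [set: {ffun 'I_n -> nat}]) term (fun=> 0) alpha x.
  apply/funext => x; rewrite -gamma_series_densityE /inner big1 ?oppr0 ?expR0 ?mulr1//.
  by move=> i _; rewrite mul0r.
exact: measurable_esum.
Qed.

Lemma gamma_series_density_ge0 x : 0 <= gamma_series_density x.
Proof.
have := gamma_series_densityE (fun=> 0) x.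
rewrite /inner big1 ?oppr0 ?expR0 ?mulr1; last by move=> i _; rewrite mul0r.
by rewrite -lee_fin => ->; apply: esum_ge0.
Qed.

(** Termwise integration produces prod_i Gamma(lambda + alpha_i) = Gamma(lambda)^n (lambda)_alpha,
    which cancels the division by (lambda)_alpha in the density. *)
Lemma laplace_gamma_series_density v : (forall i, a i < v i) ->
  (\int[leb n]_x (gamma_series_density x * expR (- inner v (tnth x)))%:E =
   (K * Gamma lambda ^+ n * (\prod_(i < n) (v i - a i)) `^ (- lambda))%:E *
   \esum_(alpha in [set: {ffun 'I_n -> nat}])
     (b alpha * monom alpha (fun i => (v i - a i)^-1))%:E)%E.
Proof.
move=> av.
have u0 i : 0 < v i - a i by rewrite subr_gt0.
under eq_integral do rewrite gamma_series_densityE.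
rewrite integral_esum// -esumZl//; last 2 first.
- by rewrite !mulr_ge0 ?powR_ge0 ?exprn_ge0// ltW// Gamma_gt0.
- move=> alpha; rewrite lee_fin mulr_ge0//.
  by apply: prodr_ge0 => i _; rewrite exprn_ge0// invr_ge0 ltW.
apply: eq_esum => alpha _; rewrite /term.
under eq_integral do rewrite EFinM.
rewrite ge0_integralZl//; last 2 first.
- by move=> x _; rewrite lee_fin prodr_ge0.
- by rewrite lee_fin mulr_ge0// divr_ge0// ltW// mpoch_gt0.
rewrite integral_leb_prod//.
have -> : (\prod_(i < n) \int[@lebesgue_measure R]_y (factor v alpha i y)%:E =
   \prod_(i < n) (Gamma (lambda + (alpha i)%:R) * (v i - a i) `^ (- (lambda + (alpha i)%:R)))%:E)%E.
  apply: eq_bigr => i _; rewrite -gamma_integral//; last by rewrite ltr_wpDr.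
  rewrite [RHS]integral_mkcond; apply: eq_integral => y _.
  rewrite patchE /factor indicE; case: ifPn => _; first by rewrite mul1r.
  by rewrite mul0r.
rewrite prodEFin -!EFinM; congr EFin.
rewrite big_split/=.
have -> : \prod_(i < n) (v i - a i) `^ (- (lambda + (alpha i)%:R)) =
   (\prod_(i < n) (v i - a i)) `^ (- lambda) * monom alpha (fun i => (v i - a i)^-1).
  rewrite powR_prod; last by move=> i; exact/ltW.
  rewrite /monom -big_split/=; apply: eq_bigr => i _.
  rewrite opprD powRD; last by rewrite (gt_eqF (u0 i)) implybT.
  by rewrite [X in _ * X]powRN powR_mulrn ?(ltW (u0 i))// exprVn.
have -> : \prod_(i < n) Gamma (lambda + (alpha i)%:R) = Gamma lambda ^+ n * mpoch lambda alpha.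
  rewrite /mpoch /poch big_split/= prodfV prodr_const card_ord mulrCA mulfV ?mulr1//.
  by rewrite expf_neq0// gt_eqF// Gamma_gt0.
have m0 := mpoch_gt0 alpha.
by field; rewrite gt_eqF.
Qed.

End GammaSeriesDensity.

(** * Factorization of P *)

Section TaylorExpansion.
Context {R : realType} {n : nat}.
Implicit Types (p : {set 'I_n} -> R) (v a u : 'I_n -> R) (S T J : {set 'I_n}).

Lemma pderiv_affine p i : pderiv i (fun theta : 'rV[R]_n => affine p (theta 0)) =
  fun theta => affine (dcoef p i) (theta 0).
Proof.
apply/funext => theta; rewrite /pderiv /derive; apply/cvg_lim => //.
apply: (@cvg_trans _ (affine (dcoef p i) (theta 0) @[h --> (0 : R)^'])); last first.
  exact: cvg_cst.
apply: near_eq_cvg; near=> h.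
have h0 : h != 0 by near: h; exact: nbhs_dnbhs_neq.
rewrite /= (_ : (h *: delta_mx 0 i + theta) 0 = coord_shift (theta 0) i h).
  by rewrite affine_shift addrAC subrr add0r /GRing.scale/= mulrC mulfK.
apply/funext => j; rewrite !mxE eqxx /= /coord_shift.
by case: eqP => [->|_]; rewrite ?mulr1 ?mulr0 ?add0r// addrC.
Unshelve. all: by end_near. Qed.

Definition dcoefs p (s : seq 'I_n) : {set 'I_n} -> R :=
  foldr (fun i q => dcoef q i) p s.

Lemma pderivs_affine p T : pderivs T (fun theta : 'rV[R]_n => affine p (theta 0)) =
  fun theta => affine (dcoefs p (enum T)) (theta 0).
Proof.
rewrite /pderivs /dcoefs; elim: (enum T) => //= i s ->.
exact: pderiv_affine.
Qed.

(** The derivative no longer involves the variables of [s], whence 0 as soon as [S] meets [s]. *)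
Lemma dcoefsE p s S : uniq s ->
  dcoefs p s S = if [disjoint s & S]%B then p ([set i in s] :|: S)%SET else 0.
Proof.
elim: s S => [|i s IHs] S /=.
  by rewrite (_ : [set i in [::]]%SET = finset.set0) ?finset.set0U ?eq_disjoint0//;
    apply/finset.setP => j; rewrite !inE.
move=> /andP[ins us]; rewrite /dcoef disjoint_cons.
case: (boolP (i \in S)) => //= iS.
rewrite IHs//.
have -> : [disjoint s & (i |: S)%SET]%B = [disjoint s & S]%B.
  rewrite !disjoint_has; congr (~~ _); apply: eq_in_has => x xs.
  by rewrite !inE; case: eqP => // xi; rewrite -xi xs in ins.
by rewrite set_cons finset.setUCA finset.setUA.
Qed.

Lemma affine_taylor p a u : affine p (fun i => a i + u i) =
  \sum_(J : {set 'I_n}) affine (dcoefs p (enum J)) a * \prod_(i in J) u i.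
Proof.
have expand S : \prod_(t in S) (a t + u t) =
    \sum_(J : {set 'I_n} | J \subset S) (\prod_(t in S :\: J) a t) * \prod_(t in J) u t.
  rewrite big_mkcond/=.
  (* Outside S the sum F + G is 1, so the product over S becomes a product over all indices; F = 0
     there kills the choices J not contained in S. *)
  pose F i := if i \in S then u i else 0; pose G i := if i \in S then a i else 1.
  rewrite (eq_bigr (fun i => F i + G i)); last first.
    by move=> i _; rewrite /F /G; case: ifP => _; rewrite ?add0r// addrC.
  rewrite bigA_distr (bigID (fun J : {set 'I_n} => J \subset S))/= [X in _ + X]big1 ?addr0.
    apply: eq_bigr => J JS; rewrite [X in _ = X * _]big_mkcond [X in _ = _ * X]big_mkcond.
    rewrite -big_split/=; apply: eq_bigr => i _; rewrite inE /F /G.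
    case: (boolP (i \in J)) => iJ /=; first by rewrite (fintype.subsetP JS _ iJ) mul1r.
    by rewrite mulr1.
  move=> J /fintype.subsetPn[i iJ iS].
  by rewrite (bigD1 i)//= iJ /F (negbTE iS) mul0r.
rewrite /affine.
under eq_bigr do rewrite expand mulr_sumr.
rewrite (exchange_big_dep predT)//=; apply: eq_bigr => J _.
rewrite mulr_suml.
rewrite (reindex_onto (fun S => J :|: S)%SET (fun S => S :\: J)%SET)/=; last first.
  by move=> S JS; rewrite finset.setDE finset.setUIr finset.setUCr finset.setIT; apply/finset.setUidPr.
rewrite [RHS](bigID (fun S : {set 'I_n} => [disjoint J & S]%B))/=.
rewrite [X in _ = _ + X]big1 ?addr0; last first.
  move=> S /negbTE JS; rewrite dcoefsE ?enum_uniq// (eq_disjoint (_ : enum J =i J)).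
    by rewrite JS !mul0r.
  by move=> x; rewrite mem_enum.
apply: eq_big => [S|S].
  rewrite finset.subsetUl /= finset.setDUl finset.setDv finset.set0U.
  by apply/eqP/idP => [<-|]; [rewrite disjoint_sym finset.disjoints_subset finset.setDE finset.subsetIr|
    rewrite disjoint_sym => /finset.setDidPl].
rewrite finset.subsetUl /= finset.setDUl finset.setDv finset.set0U => /eqP SJ.
rewrite dcoefsE ?enum_uniq// (eq_disjoint (_ : enum J =i J)); last first.
  by move=> x; rewrite mem_enum.
rewrite set_enum SJ ifT ?mulrA//.
by rewrite -SJ disjoint_sym finset.disjoints_subset finset.setDE finset.subsetIr.
Qed.

(** The Taylor expansion is reindexed by complements, because the product of u_i outside T is the
    full product times that of 1/u_i over T. *)
Lemma affine_factor p u : p [set: 'I_n]%SET != 0 -> (forall i, u i != 0) ->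
  affine p (fun i => thetaP p 0 i + u i) =
  p [set: 'I_n]%SET * (\prod_i u i) * (1 - Rpoly p (fun i => (u i)^-1)).
Proof.
move=> pn u0; rewrite affine_taylor (reindex_inj (@finset.setC_inj _))/=.
set a := thetaP p 0.
have dE T : affine (dcoefs p (enum T)) a = pderivs T (fun theta => affine p (theta 0)) (thetaP p).
  by rewrite pderivs_affine.
have coefE T : affine (dcoefs p (enum (~: T)%SET)) a =
    p [set: 'I_n]%SET * ((T == finset.set0)%:R - rcoef p T).
  rewrite /rcoef; case: ifPn => T2.
    have -> : (T == finset.set0) = false.
      by apply/negbTE; rewrite -card_gt0 (leq_trans _ T2).
    by rewrite dE sub0r mulNr opprK mulrA mulfV ?mul1r.
  rewrite subr0 /affine.
  have disj S : [disjoint enum (~: T)%SET & S]%B = (S \subset T).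
    rewrite (eq_disjoint (_ : enum (~: T)%SET =i (~: T)%SET)); last by move=> x; rewrite mem_enum.
    by rewrite disjoint_sym finset.disjoints_subset finset.setCK.
  under eq_bigr do rewrite dcoefsE ?enum_uniq// disj set_enum.
  move: T2; rewrite -ltnNge ltnS leq_eqVlt ltnS leqn0 cards_eq0 => /orP[/cards1P[i ->]|/eqP ->].
    have -> : ([set i]%SET == finset.set0) = false by rewrite -cards_eq0 cards1.
    (* For T = {i} only S empty and S = {i} contribute; their sum, the coefficient of the complement
       of {i} plus p_[n] a_i, is 0 by the choice of a. *)
    rewrite mulr0 (bigD1 finset.set0)//= (bigD1 [set i]%SET)/=; last by rewrite -cards_eq0 cards1.
    rewrite finset.sub0set big_set0 mulr1 finset.setU0 subxx big_set1 finset.setUC finset.setUCr.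
    rewrite big1 ?addr0; last first.
      move=> S /andP[S0 Si]; rewrite finset.subset1 (negbTE S0) (negbTE Si).
      by rewrite mul0r.
    by rewrite /a !mxE /ptilde; field.
  rewrite eqxx mulr1 (bigD1 finset.set0)//= finset.sub0set big_set0 mulr1.
  rewrite big1 ?addr0 ?finset.setU0 ?finset.setC0// => S S0.
  by rewrite finset.subset0 (negbTE S0) mul0r.
under eq_bigr do rewrite coefE.
rewrite /Rpoly /affine.
transitivity (\sum_(T : {set 'I_n}) p [set: 'I_n]%SET * (\prod_i u i) *
   (((T == finset.set0)%:R - rcoef p T) * \prod_(i in T) (u i)^-1)).
  apply: eq_bigr => T _.
  have -> : \prod_i u i = (\prod_(i in T) u i) * \prod_(i in (~: T)%SET) u i.
    rewrite (bigID (mem T))/=; congr (_ * _).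
    by apply: eq_bigl => i; rewrite inE.
  rewrite prodfV; field.
  by apply/prodf_neq0 => i _; exact: u0.
rewrite -mulr_sumr; congr (_ * _).
under eq_bigr do rewrite mulrBl.
rewrite sumrB; congr (_ - _).
rewrite (bigD1 finset.set0)//= eqxx big_set0 mulr1 big1 ?addr0// => T /negbTE ->.
by rewrite mul0r.
Qed.

End TaylorExpansion.

(** * Identification of the density *)

Section SignedDensity.
Context {R : realType} {n : nat}.
Local Notation T := (n.-tuple R).
Variables (gamma mu : {measure set T -> \bar R}) (f1 f2 : T -> R) (M : R).
Hypotheses (mf1 : measurable_fun [set: T] f1) (mf2 : measurable_fun [set: T] f2).
Hypotheses (f10 : forall x, 0 <= f1 x) (f20 : forall x, 0 <= f2 x).
Hypotheses (f1D : forall x, ~ nonneg_orthant x -> f1 x = 0)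
           (f2D : forall x, ~ nonneg_orthant x -> f2 x = 0).
Hypothesis gammaD : {ae gamma, forall x, nonneg_orthant x}.
Local Notation laplace_density f v :=
  (\int[mu]_x (f x * expR (- inner v (tnth x)))%:E)%E.
Hypothesis laplace_eq12 : forall v, (forall i, M <= v i) ->
  (laplace gamma v + laplace_density f2 v = laplace_density f1 v)%E.
Hypothesis laplace_lty : forall v, (forall i, M <= v i) ->
  (laplace_density f1 v < +oo)%E.

Local Notation D := (@nonneg_orthant R n).
Let mD : measurable D := measurable_nonneg_orthant.
Let fp x : R := Num.max (f1 x - f2 x) 0.
Let fn x : R := Num.max (f2 x - f1 x) 0.

Let mfp : measurable_fun [set: T] fp.
Proof. by apply: measurable_maxr => //; exact: measurable_funB. Qed.

Let mfn : measurable_fun [set: T] fn.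
Proof. by apply: measurable_maxr => //; exact: measurable_funB. Qed.

Let fp0 x : 0 <= fp x. Proof. by rewrite le_max lexx orbT. Qed.
Let fn0 x : 0 <= fn x. Proof. by rewrite le_max lexx orbT. Qed.

Let fpD x : ~ D x -> fp x = 0.
Proof. by move=> xD; rewrite /fp f1D// f2D// subrr maxxx. Qed.

Let fnD x : ~ D x -> fn x = 0.
Proof. by move=> xD; rewrite /fn f1D// f2D// subrr maxxx. Qed.

Let f12E x : f1 x + fn x = f2 x + fp x.
Proof.
rewrite /fn /fp.
by have [h|h] := leP (f2 x - f1 x) 0; have [h'|h'] := leP (f1 x - f2 x) 0; lra.
Qed.

Let integral_setT (f : T -> R) A : measurable A -> (forall x, ~ D x -> f x = 0) ->
  (\int[mu]_(x in A `&` D) (f x)%:E = \int[mu]_(x in A) (f x)%:E)%E.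
Proof.
move=> mA fD; rewrite integral_mkcondr; apply: eq_integral => x _.
by rewrite patchE; case: ifPn => // /negP; rewrite inE => xD; rewrite fD.
Qed.

Let mexp v : measurable_fun [set: T] (fun x => (expR (- inner v (tnth x)))%:E).
Proof. by apply/measurable_EFinP; exact: measurable_laplace_fun. Qed.

Let mfexp (f : T -> R) v : measurable_fun [set: T] f ->
  measurable_fun [set: T] (fun x : T => (f x * expR (- inner v (tnth x)))%:E).
Proof.
move=> mf; apply/measurable_EFinP; apply: measurable_funM => //.
exact: measurable_laplace_fun.
Qed.

Let fexp0 (f : T -> R) v x : (forall x, 0 <= f x) -> [set: T] x ->
  (0 <= (f x * expR (- inner v (tnth x)))%:E)%E.
Proof. by move=> f0 _; rewrite lee_fin mulr_ge0 ?expR_ge0. Qed.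

Let laplace_density_ge0 (f : T -> R) v : (forall x, 0 <= f x) ->
  (0 <= laplace_density f v)%E.
Proof. by move=> f0; apply: integral_ge0 => x _; exact: fexp0. Qed.

(** From f1 + fn = f2 + fp, cancelling the transform of [f2], which is finite because that of [f1]
    bounds it. The passage to [fp] and [fn] matters since [f1] and [f2] may overlap, whereas [fp]
    vanishes wherever [fn] does not. *)
Let laplace_pn v : (forall i, M <= v i) ->
  (laplace gamma v + laplace_density fn v = laplace_density fp v)%E.
Proof.
move=> Mv.
have l0 : (0 <= laplace gamma v)%E.
  by apply: integral_ge0 => x _; rewrite lee_fin expR_ge0.
have fin2 : laplace_density f2 v \is a fin_num.
  rewrite ge0_fin_numE ?laplace_density_ge0//; apply: le_lt_trans (laplace_lty Mv).
  by rewrite -laplace_eq12// leeDr.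
have E : (laplace_density f1 v + laplace_density fn v =
    laplace_density f2 v + laplace_density fp v)%E.
  rewrite -!ge0_integralD//; try by [exact: mfexp|move=> x ?; exact: fexp0].
  by apply: eq_integral => x _; rewrite -!EFinD -!mulrDl f12E.
rewrite -(addeK (laplace gamma v + _) fin2) -(addeK (laplace_density fp v) fin2).
congr (_ - _)%E.
by rewrite -addeA (addeC (laplace_density fn v)) addeA laplace_eq12// E addeC.
Qed.

Let laplace_fin v : (forall i, M <= v i) -> (laplace_density fp v < +oo)%E.
Proof.
move=> Mv; apply: le_lt_trans (laplace_lty Mv).
apply: ge0_le_integral => //; try by [exact: mfexp|move=> x ?; exact: fexp0].
move=> x _; rewrite lee_fin ler_wpM2r ?expR_ge0//.
by rewrite /fp ge_max f10 gerBl f20.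
Qed.

(* Applied on [f1 < f2], where [fp] vanishes, gamma + fn mu = fp mu gives fn = 0. *)
Lemma signed_density_of_laplace A : measurable A ->
  gamma A = (\int[mu]_(x in A) (f1 x - f2 x)%:E)%E.
Proof.
move=> mA.
have [m2 [m2A m2E]] := density_measure mu mfn fn0.
have [m1 [m1A m1E]] := density_measure mu mfp fp0.
pose m3 : {measure set T -> \bar R} := measure_add gamma m2.
have expfD (f : T -> R) v : measurable_fun [set: T] f -> (forall x, ~ D x -> f x = 0) ->
    (\int[mu]_(x in D) ((expR (- inner v (tnth x)))%:E * (f x)%:E) =
     laplace_density f v)%E.
  move=> mf fD; rewrite -[RHS]integral_setT//; last first.
    by move=> x /fD ->; rewrite mul0r.
  by rewrite setTI; apply: eq_integral => x _; rewrite -EFinM mulrC.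
have gammaDE v : (\int[gamma]_(x in D) (expR (- inner v (tnth x)))%:E = laplace gamma v)%E.
  rewrite integral_mkcond; apply: ae_eq_integral => //.
  - by apply: (measurable_restrictT _ mD).1; exact: measurable_funTS.
  - by apply: filterS gammaD => x Dx _; rewrite patchE mem_set.
have exp0 v (x : T) : (0 <= (expR (- inner v (tnth x)))%:E)%E by rewrite lee_fin expR_ge0.
have uniq B : measurable B -> m3 (B `&` D) = m1 (B `&` D).
  move=> mB; apply: (laplace_unique (M := M)) => //.
    move=> v Mv; rewrite ge0_integral_measure_add//; last exact: measurable_funTS.
    by rewrite m2E// m1E// gammaDE !expfD// laplace_pn.
  rewrite ge0_integral_measure_add//; last exact: measurable_funTS.
  by rewrite m2E// gammaDE !expfD// laplace_pn// laplace_fin.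
have gammaC : gamma (~` D) = 0%E.
  by apply: measure_negligible => //; exact: measurableC.
have gammaAD B : measurable B -> gamma (B `&` D) = gamma B.
  move=> mB; rewrite [RHS](measureDI _ mB mD).
  rewrite [X in (X + _)%E](_ : _ = 0%E) ?add0e//.
  apply/eqP; rewrite -measure_le0 -gammaC; apply: le_measure; rewrite ?inE//.
  - exact: measurableD.
  - exact: measurableC.
have {}uniq B : measurable B ->
    (gamma B + \int[mu]_(x in B) (fn x)%:E = \int[mu]_(x in B) (fp x)%:E)%E.
  move=> mB; have := uniq B mB.
  have -> : m3 (B `&` D) = (gamma (B `&` D) + m2 (B `&` D))%E by exact: measure_addE.
  rewrite gammaAD// m2A; last exact: measurableI.
  rewrite m1A; last exact: measurableI.
  by rewrite !integral_setT.
pose E := [set x | f1 x < f2 x].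
have mE : measurable E.
  rewrite (_ : E = [set: T] `&` (fun x => f2 x - f1 x) @^-1` `]0, +oo[).
    by apply: measurable_funB.
  by rewrite setTI; apply/seteqP; split => x /=; rewrite in_itv/= andbT subr_gt0.
have intE : (\int[mu]_(x in E) (fn x)%:E = 0)%E.
  have := uniq E mE; rewrite [in RHS]integral0_eq; last first.
    move=> x Ex; rewrite /fp; congr EFin; apply/max_idPr.
    by rewrite subr_le0 ltW.
  move=> /eqP; rewrite padde_eq0//; first by move=> /andP[_ /eqP].
  by apply: integral_ge0 => x _; rewrite lee_fin.
have intA : (\int[mu]_(x in A) (fn x)%:E = 0)%E.
  apply/eqP; rewrite eq_le; apply/andP; split; last first.
    by apply: integral_ge0 => x _; rewrite lee_fin.
  rewrite -intE [leRHS]integral_mkcond.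
  apply: (@le_trans _ _ (\int[mu]_x (fn x)%:E)%E).
    by apply: ge0_subset_integral => // [|x _]; [exact/measurable_EFinP|rewrite lee_fin].
  rewrite le_eqVlt; apply/orP; left; apply/eqP; apply: eq_integral => x _.
  rewrite patchE; case: ifPn => // /negP; rewrite inE => xE; congr EFin.
  by apply/max_idPr; rewrite subr_le0 leNgt; apply/negP.
have := uniq A mA; rewrite intA adde0 => ->.
rewrite [RHS]integralE.
have -> : (\int[mu]_(x in A) (fun x => (f1 x - f2 x)%:E)^\- x = 0)%E.
  rewrite -[RHS]intA; apply: eq_integral => x _.
  by rewrite funenegE -EFinN opprB -EFin_max.
rewrite sube0; apply: eq_integral => x _.
by rewrite funeposE -EFin_max.
Qed.

End SignedDensity.

(** * Absolute convergence of the density series *)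

Section PowerSeriesBounds.
Context {R : realType} {n : nat}.

(** Halving the radius gives a closed box, so the expansion may be used at its corner (e, ...,
    e). *)
Lemma power_series_at0_box (f : 'rV[R]_n -> R) (c : {ffun 'I_n -> nat} -> R) :
  power_series_at0 f c -> exists2 e : R, 0 < e &
    forall v : 'I_n -> R, (forall i, `|v i| <= e) ->
      f (\row_i v i) = abs_sum setT (fun alpha => c alpha * monom alpha v) /\
      abs_summable setT (fun alpha => c alpha * monom alpha v).
Proof.
move=> /nbhs_ballP[d /= d0 hd]; exists (d / 2); first by rewrite divr_gt0.
move=> v ve; have [] := hd (\row_i v i).
  split => // i j; rewrite !mxE /ball /= sub0r normrN.
  by apply: le_lt_trans (ve j) _; rewrite ltr_pdivrMr// ltr_pMr// ltr1n.
by rewrite (_ : (\row_i v i) 0 = v)//; apply/funext => i; rewrite mxE.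
Qed.

(** [Gamma_ge] with M = x_i/e: up to a constant, (lambda)_k grows at least like (x_i/e)^k, so
    convergence at an arbitrary [x] reduces to convergence at (e, ..., e). *)
Lemma monom_mpoch_le (lambda e : R) (x : 'I_n -> R) : 0 < lambda -> 0 < e ->
  (forall i, 0 <= x i) -> exists2 C : R, 0 <= C & forall alpha,
    monom alpha x / mpoch lambda alpha <= C * monom alpha (fun=> e).
Proof.
move=> l0 e0 x0.
pose q i := (x i / e + 2)^-1 * expR (- (x i / e + 2)).
have q0 i : 0 < q i.
  by rewrite mulr_gt0 ?expR_gt0// invr_gt0 ltr_wpDl// divr_ge0// ltW.
have G0 := Gamma_gt0 l0.
exists (\prod_(i < n) (Gamma lambda / q i)).
  by apply: prodr_ge0 => i _; rewrite divr_ge0// ltW.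
move=> alpha; rewrite /monom /mpoch -prodfV -!big_split/=.
apply: ler_prod => i _.
have Gk0 : 0 < Gamma (lambda + (alpha i)%:R) by rewrite Gamma_gt0// ltr_wpDr.
rewrite divr_ge0 ?exprn_ge0 ?divr_ge0 ?(ltW G0) ?(ltW Gk0)//=.
have := @Gamma_ge R lambda (x i / e) (alpha i) l0.
rewrite divr_ge0 ?(ltW e0)// => /(_ isT); rewrite -/(q i) => h.
rewrite /poch invf_div mulrA ler_pdivrMr//.
have -> : x i ^+ alpha i = (x i / e) ^+ alpha i * e ^+ alpha i.
  by rewrite -exprMn divfK// gt_eqF.
have -> : (x i / e) ^+ alpha i * e ^+ alpha i * Gamma lambda =
   ((x i / e) ^+ alpha i * q i) * (e ^+ alpha i * (Gamma lambda / q i)).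
  by field; rewrite !gt_eqF.
rewrite [leRHS]mulrC [X in _ <= _ * X]mulrC.
apply: ler_pM => //.
  by rewrite mulr_ge0 ?exprn_ge0 ?divr_ge0// ltW.
by rewrite mulr_ge0 ?exprn_ge0 ?divr_ge0// ltW.
Qed.

Lemma abs_summable_gamma (lambda e : R) (c : {ffun 'I_n -> nat} -> R)
    (x : n.-tuple R) : 0 < lambda -> 0 < e -> (forall i, 0 <= tnth x i) ->
  abs_summable setT (fun alpha => c alpha * monom alpha (fun=> e)) ->
  abs_summable setT (fun alpha => c alpha / mpoch lambda alpha * monom alpha (tnth x)).
Proof.
move=> l0 e0 x0; rewrite /abs_summable /summable => sumc.
have [C C0 hC] := monom_mpoch_le l0 e0 x0.
apply: (@le_lt_trans _ _ (\esum_(alpha in [set: {ffun 'I_n -> nat}])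
    (C%:E * `|(c alpha * monom alpha (fun=> e))%:E|)%E)); last first.
  by rewrite esumZl// lte_mul_pinfty.
apply: le_esum => alpha _; rewrite /= -EFinM lee_fin -mulrA normrM.
rewrite (normrM (c alpha)) mulrCA ler_wpM2l//.
have m0 : 0 < mpoch lambda alpha by exact: mpoch_gt0.
rewrite [leLHS]ger0_norm; last first.
  by rewrite mulr_ge0 ?invr_ge0 ?(ltW m0)//; apply: prodr_ge0 => i _; exact: exprn_ge0.
rewrite mulrC; apply: le_trans (hC alpha) _.
by rewrite ler_wpM2l// ler_norm.
Qed.

End PowerSeriesBounds.

Section AbsSum.
Context {R : realType} {I : choiceType}.
Implicit Types (D : set I) (f k : I -> R).

(** As k >= 0, the positive and negative parts of c k are those of c times k. Indices with c = 0
    contribute to neither, so the restricted sum has the same value. *)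
Lemma abs_sum_posneg (c k : I -> R) : (forall i, 0 <= k i) ->
  abs_summable setT (fun i => c i * k i) ->
  let sp := \esum_(i in [set: I]) (Num.max (c i) 0 * k i)%:E in
  let sn := \esum_(i in [set: I]) (Num.max (- c i) 0 * k i)%:E in
  [/\ (sp < +oo)%E, (sn < +oo)%E,
    abs_sum setT (fun i => c i * k i) = fine sp - fine sn &
    abs_sum [set i | c i != 0] (fun i => c i * k i) = fine sp - fine sn].
Proof.
move=> k0 ck sp sn.
have posE i : ((EFin \o (fun i => (c i * k i)%R))^\+ i)%E = (Num.max (c i) 0 * k i)%:E.
  by rewrite funeposE /= -EFin_max maxr_pMl// mul0r.
have negE i : ((EFin \o (fun i => (c i * k i)%R))^\- i)%E = (Num.max (- c i) 0 * k i)%:E.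
  by rewrite funenegE /= -EFin_max maxr_pMl// mul0r mulNr.
have spE : \esum_(i in [set: I]) ((EFin \o (fun i => (c i * k i)%R))^\+ i)%E = sp.
  by apply: eq_esum => i _; rewrite posE.
have snE : \esum_(i in [set: I]) ((EFin \o (fun i => (c i * k i)%R))^\- i)%E = sn.
  by apply: eq_esum => i _; rewrite negE.
have splty : (sp < +oo)%E.
  rewrite -spE; have := summable_funepos ck; rewrite /summable.
  by under eq_esum do rewrite gee0_abs//.
have snlty : (sn < +oo)%E.
  rewrite -snE; have := summable_funeneg ck; rewrite /summable.
  by under eq_esum do rewrite gee0_abs//.
have sp0 : (0 <= sp)%E.
  by apply: esum_ge0 => i _; rewrite lee_fin mulr_ge0// le_max lexx orbT.
have sn0 : (0 <= sn)%E.
  by apply: esum_ge0 => i _; rewrite lee_fin mulr_ge0// le_max lexx orbT.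
have E : abs_sum setT (fun i => c i * k i) = fine sp - fine sn.
  by rewrite /abs_sum spE snE fineB// ge0_fin_numE.
split => //; rewrite -E /abs_sum; congr (fine (_ - _)%E); rewrite esum_mkcond;
  apply: eq_esum => i _; case: ifPn => //; rewrite notin_setE /= => /negP;
  rewrite negbK => /eqP ci; rewrite ?posE ?negE ci ?oppr0 maxxx mul0r//.
Qed.

End AbsSum.

(** * The density formula *)

Theorem theorem16 (R : realType) (n : nat) (hn : (1 <= n)%N)
    (lambda : R) (hlambda : 0 < lambda)
    (p : {set 'I_n} -> R)
    (hp0 : p finset.set0 = 1)
    (hpT : forall T : {set 'I_n}, p T != 0)
    (hpi : forall i : 'I_n, 0 < p [set i]%SET)
    (hpn : 0 < p [set: 'I_n]%SET)
    (gamma : probability (n.-tuple R) R)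
    (hgamma : is_mgamma gamma (fun theta => affine p (theta 0)) lambda)
    (hinfdiv :
      mgamma_infinitely_divisible (fun theta => affine p (theta 0)) lambda)
    (c : {ffun 'I_n -> nat} -> R)
    (hc : power_series_at0 (fun z => (1 - Rpoly p (z 0)) `^ (- lambda)) c) :
  [/\ forall x : n.-tuple R, pos_orthant x ->
        abs_summable setT
          (fun alpha => c alpha / mpoch lambda alpha * monom alpha (tnth x)),
      forall A : set (n.-tuple R), measurable A ->
        gamma A = (\int[leb n]_(x in A)
          (mgamma_density p lambda c setT x)%:E)%E
    & forall A : set (n.-tuple R), measurable A ->
        gamma A = (\int[leb n]_(x in A)
          (mgamma_density p lambda c [set alpha | c alpha != 0%R] x)%:E)%E].
Proof.
pose K := p [set: 'I_n]%SET `^ (- lambda) / Gamma lambda ^+ n.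
have G0 : 0 < Gamma lambda by exact: Gamma_gt0.
have K0 : 0 <= K by rewrite divr_ge0 ?powR_ge0 ?exprn_ge0 ?(ltW G0).
pose a := thetaP p 0.
have [e e0 he] := power_series_at0_box hc.
have summ x : (forall i, 0 <= tnth x i) -> abs_summable setT
    (fun alpha => c alpha / mpoch lambda alpha * monom alpha (tnth x)).
  move=> x0; apply: (abs_summable_gamma hlambda e0 x0).
  by have [i|_ //] := he (fun=> e); rewrite (ger0_norm (ltW e0)).
pose cp alpha := Num.max (c alpha) 0.
pose cn alpha := Num.max (- c alpha) 0.
have cp0 alpha : 0 <= cp alpha by rewrite le_max lexx orbT.
have cn0 alpha : 0 <= cn alpha by rewrite le_max lexx orbT.
have kern0 (x : n.-tuple R) alpha : (forall i, 0 <= tnth x i) ->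
    0 <= (mpoch lambda alpha)^-1 * monom alpha (tnth x).
  move=> x0; rewrite mulr_ge0 ?invr_ge0 ?(ltW (mpoch_gt0 _ _))//.
  by apply: prodr_ge0 => i _; rewrite exprn_ge0.
have series (x : n.-tuple R) : (forall i, 0 <= tnth x i) ->
    [/\ (gamma_series lambda cp x < +oo)%E, (gamma_series lambda cn x < +oo)%E,
      abs_sum setT (fun alpha => c alpha / mpoch lambda alpha * monom alpha (tnth x)) =
        fine (gamma_series lambda cp x) - fine (gamma_series lambda cn x) &
      abs_sum [set alpha | c alpha != 0]
        (fun alpha => c alpha / mpoch lambda alpha * monom alpha (tnth x)) =
        fine (gamma_series lambda cp x) - fine (gamma_series lambda cn x)].
  move=> x0; have E (b : {ffun 'I_n -> nat} -> R) :
      (fun alpha => b alpha / mpoch lambda alpha * monom alpha (tnth x)) =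
      (fun alpha => b alpha * ((mpoch lambda alpha)^-1 * monom alpha (tnth x))).
    by apply/funext => alpha; rewrite mulrA.
  have sE b : gamma_series lambda b x = \esum_(alpha in [set: {ffun 'I_n -> nat}])
      (b alpha * ((mpoch lambda alpha)^-1 * monom alpha (tnth x)))%:E.
    by apply: eq_esum => alpha _; rewrite mulrA.
  have := summ x x0; rewrite !E !sE.
  exact: (abs_sum_posneg (fun alpha => kern0 x alpha x0)).
have pos_ge0 (x : n.-tuple R) : pos_orthant x -> forall i, 0 <= tnth x i.
  by move=> x0 i; exact/ltW.
pose f1 := gamma_series_density lambda K a cp.
pose f2 := gamma_series_density lambda K a cn.
have lty1 x : pos_orthant x -> (gamma_series lambda cp x < +oo)%E.
  by move=> /pos_ge0/series[].
have lty2 x : pos_orthant x -> (gamma_series lambda cn x < +oo)%E.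
  by move=> /pos_ge0/series[].
have densityE D x : D = setT \/ D = [set alpha | c alpha != 0] ->
    mgamma_density p lambda c D x = f1 x - f2 x.
  move=> hD; rewrite /mgamma_density /f1 /f2 /gamma_series_density indicE.
  case: (boolP (x \in _)) => [|_]; last by rewrite !mulr0 subrr.
  rewrite inE => /pos_ge0/series[_ _ h1 h2].
  by rewrite !mulr1 -mulrBr; case: hD => ->; rewrite ?h1 ?h2.
have [theta near_theta] : exists theta, near_laplace_eq gamma p lambda theta.
  case: hgamma => Theta [] [theta] /nbhs_ballP[d /= d0 hd] hTheta.
  exists (theta 0); exists d => // w wd.
  have [|h1 h2] := hTheta (\row_i w i).
    apply: hd; split => // i j; rewrite !mxE /ball /= distrC ord1.
    exact: wd.
  have wE : (\row_i w i) 0 = w by apply/funext => j; rewrite mxE.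
  by move: h1 h2; rewrite wE.
have gamma_fin : (gamma setT < +oo)%E by rewrite probability_setT ltry.
have [aeD lap] := laplace_positive_orthant hlambda gamma_fin hp0 hpi near_theta.
(* For v_i >= M one has v_i - a_i >= 1/e, so z_i = 1/(v_i - a_i) lies in the box where
   [1 - R]^(-lambda) is expanded; M > 0 puts v in the orthant where [lap] applies. *)
pose M := 1 + \sum_i `|a i| + e^-1.
have M0 : 0 < M.
  by rewrite /M ltr_wpDr ?invr_ge0 ?(ltW e0)// ltr_wpDr// sumr_ge0.
have main A : measurable A -> gamma A = (\int[leb n]_(x in A) (f1 x - f2 x)%:E)%E.
  move=> mA.
  have vanish b x : ~ nonneg_orthant x -> gamma_series_density lambda K a b x = 0.
    move=> xD; rewrite /gamma_series_density indicE memNset ?mulr0//.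
    by move=> /pos_ge0.
  have lapv v : (forall i, M <= v i) ->
     (laplace gamma v + \int[leb n]_x (f2 x * expR (- inner v (tnth x)))%:E =
      \int[leb n]_x (f1 x * expR (- inner v (tnth x)))%:E)%E /\
     (\int[leb n]_x (f1 x * expR (- inner v (tnth x)))%:E < +oo)%E.
    move=> Mv.
    have u_ge i : e^-1 <= v i - a i.
      have : `|a i| <= \sum_j `|a j| by rewrite [leRHS](bigD1 i)//= lerDl sumr_ge0.
      by have := Mv i; have := ler_norm (a i); rewrite /M; lra.
    have u0 i : 0 < v i - a i by apply: lt_le_trans (u_ge i); rewrite invr_gt0.
    have av i : a i < v i by rewrite -subr_gt0.
    have [] := lap v; first by move=> i; apply: lt_le_trans (Mv i).
    move=> Pv0 ->.
    rewrite !laplace_gamma_series_density//.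
    have := affine_factor (u := fun i => v i - a i) (lt0r_neq0 hpn) (fun i => lt0r_neq0 (u0 i)).
    rewrite (_ : (fun i => _ + (v i - a i)) = v); last first.
      by apply/funext => i; rewrite addrC subrK.
    set U := \prod_i _; set z := (fun i => (v i - a i)^-1); move=> PE.
    have U0 : 0 < U by apply: prodr_gt0 => i _.
    have z0 i : 0 <= z i by rewrite invr_ge0 ltW.
    have ze i : `|z i| <= e.
      by rewrite ger0_norm// /z -[leRHS]invrK lef_pV2 ?posrE// invr_gt0.
    have [zE zS] := he z ze.
    have monz alpha : 0 <= monom alpha z by apply: prodr_ge0 => i _; rewrite exprn_ge0.
    have [] := abs_sum_posneg monz zS.
    set sp := esum _ _; set sn := esum _ _ => spl snl spE _.
    have sp0 : (0 <= sp)%E.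
      by apply: esum_ge0 => i _; rewrite lee_fin; apply: mulr_ge0; [exact: cp0|].
    have sn0 : (0 <= sn)%E.
      by apply: esum_ge0 => i _; rewrite lee_fin; apply: mulr_ge0; [exact: cn0|].
    have spf : sp \is a fin_num by rewrite ge0_fin_numE.
    have snf : sn \is a fin_num by rewrite ge0_fin_numE.
    (* This sign comes from P(v) > 0; it allows the real power to be distributed over the
       factorization of P. *)
    have R0 : 0 < 1 - Rpoly p z.
      by move: Pv0; rewrite PE pmulr_rgt0// mulr_gt0.
    have rowE : (\row_i z i) 0 = z by apply/funext => j; rewrite mxE.
    move: zE; rewrite rowE spE => zE.
    have KE : K * Gamma lambda ^+ n * U `^ (- lambda) = (p [set: 'I_n]%SET * U) `^ (- lambda).
      by rewrite /K divfK ?expf_neq0 ?gt_eqF// powRM// ltW.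
    rewrite KE PE powRM ?mulr_ge0 ?(ltW hpn) ?(ltW U0) ?(ltW R0)// zE.
    rewrite -(fineK spf) -(fineK snf) -!EFinM -EFinD; split; last by rewrite ltry.
    by congr EFin; rewrite mulrBr subrK.
  apply: (@signed_density_of_laplace R n gamma (leb n) f1 f2 M) => //.
  - exact: measurable_gamma_series_density.
  - exact: measurable_gamma_series_density.
  - exact: gamma_series_density_ge0.
  - exact: gamma_series_density_ge0.
  - exact: vanish.
  - exact: vanish.
  - by move=> v /lapv[].
  - by move=> v /lapv[].
split.
- by move=> x /pos_ge0 x0; exact: summ.
- move=> A mA; rewrite main//; apply: eq_integral => x _.
  by rewrite densityE//; left.
- move=> A mA; rewrite main//; apply: eq_integral => x _.
  by rewrite densityE//; right.
Qed.
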